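(* Let $\mathbf{k}$ be a commutative ground ring, let $M$ be a compact, connected, $\mathbf{k}$-oriented manifold of even dimension $m$ such that $A=H^*(M;\mathbf{k})$ is a graded commutative Frobenius algebra over $\mathbf{k}$, and let $\Gamma$ be any (finite) graph, with $n$ vertices. Then the map $$F:(\mathcal{C}^*_{BS}(\Gamma),\delta)\to (R(\Gamma,A),d),\qquad F(G_S\otimes x)=[G_S\otimes x]\quad (S\subseteq E(\Gamma),\ x\in A_S),$$ is a quasi equivalence, i.e. a map of complexes inducing an isomorphism in homology.
   Context: Frobenius structure. A graded commutative Frobenius algebra $A$ over $\mathbf{k}$ is a graded commutative ring, free and finite as a module over $\mathbf{k}=A^0$, with a perfect, graded symmetric pairing $\langle-,-\rangle:A\otimes A\to\mathbf{k}$ satisfying $\langle ab,c\rangle=\langle a,bc\rangle$. If each $H^i(M;\mathbf{k})$ is a free $\mathbf{k}$-module, $A=H^*(M;\mathbf{k})$ is such an algebra, with pairing of degree $-m$. On $A\otimes A$ (product $(a\otimes b)(c\otimes d)=(-1)^{|b||c|}ac\otimes bd$) use the pairing $\langle a\otimes b,c\otimes d\rangle_2=(-1)^{|b||c|}\langle a,c\rangle\langle b,d\rangle$. The diagonal class $\Delta\in A\otimes A$ is defined by $\langle a\otimes b,\Delta\rangle_2=\langle ab,1\rangle$ for all $a,b$; it satisfies $(a\otimes1)\Delta=(1\otimes a)\Delta$. Notation. The vertices of $\Gamma$ are $1,\dots,n$; an edge joining $i\le j$ is written $\alpha:i\to j$, and the edges have a chosen ordering (lexicographic in $(i,j)$).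 For $a\in A$, $a[i]=p_i^*(a)\in A^{\otimes n}\cong H^*(M^n;\mathbf{k})$ is $1\otimes\cdots\otimes a\otimes\cdots\otimes1$ with $a$ in position $i$; $p_{i,j}^*:A^{\otimes2}\to A^{\otimes n}$, $a\otimes b\mapsto a[i]\,b[j]$, is the pullback along the projection $M^n\to M^2$ to coordinates $i,j$. For $S\subseteq E(\Gamma)$, $[\Gamma:S]$ is the graph with all vertices of $\Gamma$ and edge set $S$, $l(S)$ is its number of connected components, and $$A_S=A^{\otimes n}/\bigl(a[i]-a[j]: a\in A,\ (\alpha:i\to j)\in S\bigr)\cong A^{\otimes l(S)}$$ (one tensor factor per component of $[\Gamma:S]$). The complex $\mathcal{C}^*_{BS}(\Gamma)$ (dual of the Baranovsky–Sazdanović graph complex). As a module, $\mathcal{C}^*_{BS}(\Gamma)=\bigoplus_{S\subseteq E(\Gamma)}G_S\otimes A_S$, where $G_S$ is the exterior product, in ascending order, of generators $G_\alpha$ for the edges $\alpha\in S$. The differential is $\delta(G_S\otimes x)=\sum_{\alpha\in S}(-1)^{\nu}\delta_\alpha(G_S\otimes x)$, where $\nu$ is the position of $\alpha$ in $S$ in ascending order (counted as the number of edges of $S$ preceding $\alpha$), and for $\alpha:i\to j$ in $S$: if $l(S\smallsetminus\alpha)=l(S)$ (so $A_{S\smallsetminus\alpha}=A_S$), $\delta_\alpha(G_S\otimes x)=G_{S\smallsetminus\alpha}\otimes x$; if $l(S\smallsetminus\alpha)=l(S)+1$, $\delta_\alpha(G_S\otimes x)=G_{S\smallsetminus\alpha}\otimes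 p_{i,j}^*(\Delta)\,\tilde x$, where $\tilde x\in A_{S\smallsetminus\alpha}$ is any lift of $x$. The element $G_S\otimes a_1\otimes\dots\otimes a_{l(S)}$ is assigned the grading $(m-1)r_{\mathrm{ext}}-r_{\mathrm{int}}+\sum_i|a_i|$, where $r_{\mathrm{ext}}$ is the number of external edges of $S$ (those whose removal disconnects a component) and $r_{\mathrm{int}}$ the number of internal edges (those whose removal does not disconnect a component). The differential graded algebra $R(\Gamma,A)$. It is the quotient of $\Lambda[G_{a,b}]\otimes A^{\otimes n}$, where $\Lambda[G_{a,b}]$ is the exterior algebra on generators $G_{a,b}$ of degree $m-1$ corresponding to the edges $(a,b)\in E(\Gamma)$, by the relations: (1) $G_{a,b}=G_{b,a}$; (2) $p_a^*(x)G_{a,b}=p_b^*(x)G_{a,b}$ for $x\in A$; (3) for every cycle $\{(v_1,v_2),\dots,(v_{k-1},v_k),(v_k,v_1)\}\subseteq E(\Gamma)$ with $k\ge3$ vertices $v_1,\dots,v_k$, the generalised Arnold relation $\sum_i(-1)^iG_{v_1,v_2}\cdots\widehat{G}_{v_i,v_{i+1}}\cdots G_{v_k,v_1}=0$ (with $v_{k+1}=v_1$, hat meaning omitted). The differential $d$ is the derivation with $d(G_{a,b})=p_{a,b}^*\Delta$ and $d=0$ on $A^{\otimes n}$. The bracket $[\,\cdot\,]$ denotes the class in $R(\Gamma,A)$.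
   Formalization: The graph Γ is assumed to have no loops (parallel edges are allowed): for one vertex with a loop α and M = S², δ(G_α⊗1) = 1 but d(G_α) is the Euler class of M, so F is not a map of complexes. *)

(* Defs.v *)
From HB Require Import structures.
From mathcomp Require Import all_boot all_order all_algebra.
From mathcomp Require Import generic_quotient ring_quotient.
From mathcomp Require Import all_classical reals topology normedtype.

Set Implicit Arguments.
Unset Strict Implicit.
Unset Printing Implicit Defensive.

Import Order.TTheory GRing.Theory Num.Theory.
Import numFieldNormedType.Exports.

Local Open Scope ring_scope.

Record submodule (k : pzRingType) (V : lmodType k) := Submodule {
  in_submod :> V -> Prop;
  submod0 : in_submod 0;
  submodD : forall x y, in_submod x -> in_submod y -> in_submod (x + y);
  submodZ : forall c x, in_submod x -> in_submod (c *: x) }.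

Section QuotientModule.
Variables (k : pzRingType) (V : lmodType k) (N : submodule V).

Definition submod_pred : {pred V} := fun x => `[< N x >].

Lemma submod_pred_closed : zmod_closed submod_pred.
Proof.
split=> [|x y /asboolP Nx /asboolP Ny]; first exact/asboolP/submod0.
by apply/asboolP/submodD=> //; rewrite -scaleN1r; apply: submodZ.
Qed.

HB.instance Definition _ := GRing.isZmodClosed.Build V submod_pred
  submod_pred_closed.

Definition quotmod : Type := Quotient.quot submod_pred.
HB.instance Definition _ := GRing.Zmodule.on quotmod.

Definition cls (x : V) : quotmod := (\pi_(Quotient.quot submod_pred) x)%qT.
Definition rep (q : quotmod) : V := repr (q : Quotient.quot submod_pred).

Lemma repK q : cls (rep q) = q.
Proof. exact: (@reprK _ (Quotient.quot submod_pred)). Qed.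

Lemma clsP x y : cls x = cls y <-> N (x - y).
Proof.
split=> [/eqP|Nxy]; first by rewrite -Quotient.idealrBE => /asboolP.
by apply/eqP; rewrite -Quotient.idealrBE; apply/asboolP.
Qed.

Lemma cls_is_additive : zmod_morphism cls.
Proof. exact: (raddfB (\pi_(Quotient.quot submod_pred)%qT)). Qed.

HB.instance Definition _ := GRing.isZmodMorphism.Build V quotmod cls
  cls_is_additive.

Definition quot_scale (c : k) (q : quotmod) : quotmod := cls (c *: rep q).

Lemma quot_scale_cls c x : quot_scale c (cls x) = cls (c *: x).
Proof. by apply/clsP; rewrite -scalerBr; apply/submodZ/clsP; rewrite repK. Qed.

Lemma quot_scaleA a b q : quot_scale a (quot_scale b q) = quot_scale (a * b) q.
Proof. by rewrite -[q]repK !quot_scale_cls scalerA. Qed.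

Lemma quot_scale1 : left_id 1 quot_scale.
Proof. by move=> q; rewrite -[q]repK quot_scale_cls scale1r. Qed.

Lemma quot_scaleDr : right_distributive quot_scale +%R.
Proof.
move=> c q r; rewrite -[q]repK -[r]repK -raddfD !quot_scale_cls.
by rewrite scalerDr raddfD.
Qed.

Lemma quot_scaleDl q : {morph quot_scale^~ q : a b / a + b}.
Proof. by move=> a b; rewrite -[q]repK !quot_scale_cls scalerDl raddfD. Qed.

HB.instance Definition _ := GRing.Zmodule_isLmodule.Build k quotmod
  quot_scaleA quot_scale1 quot_scaleDr quot_scaleDl.

Lemma cls_is_scalable : scalable cls.
Proof. by move=> c x; rewrite -quot_scale_cls. Qed.

HB.instance Definition _ := GRing.isScalable.Build k V quotmod *:%R cls
  cls_is_scalable.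
End QuotientModule.

Section Singular.
Local Open Scope classical_set_scope.
Variable R : realType.

Definition simplex (q : nat) : set 'rV[R]_q.+1 :=
  fun t => (forall i, 0 <= t ord0 i) /\ \sum_i t ord0 i = 1.

(* The affine map of standard simplices sending vertex [i] to vertex [f i]. *)
Definition simplex_fun p q (f : 'I_p.+1 -> 'I_q.+1) (t : 'rV[R]_p.+1) :
  'rV[R]_q.+1 := \row_j \sum_(i | f i == j) t ord0 i.

Lemma simplex_funP p q (f : 'I_p.+1 -> 'I_q.+1) t :
  simplex t -> simplex (simplex_fun f t).
Proof.
move=> [t0 t1]; split=> [j|]; first by rewrite mxE sumr_ge0.
under eq_bigr do rewrite mxE.
by rewrite -t1 [RHS](partition_big f predT).
Qed.

Definition simplex_map p q (f : 'I_p.+1 -> 'I_q.+1) (t : set_type (@simplex p)) :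
  set_type (@simplex q) :=
  exist _ (simplex_fun f (set_val t))
    (mem_set (simplex_funP f (set_mem (svalP t)))).

Lemma simplex_fun_continuous p q (f : 'I_p.+1 -> 'I_q.+1) :
  continuous (simplex_fun f).
Proof.
move=> t A [P nP sPA].
have nbP i j : \forall s \near t, P i j (simplex_fun f s i j).
  have cvg_ij : simplex_fun f s i j @[s --> t] --> simplex_fun f t i j.
    rewrite mxE; under eq_fun do rewrite mxE.
    apply: cvg_big => [||l _]; first exact: add_continuous.
      exact: nbhs_filter.
    exact: coord_continuous.
  exact: cvg_ij (nP i j).
have nF : Filter (nbhs t) by exact: nbhs_filter.
have nbP_all : \forall s \near t, forall i j, P i j (simplex_fun f s i j).
  apply: (@filter_forall _ _ _ (nbhs t)) => i.
  by apply: (@filter_forall _ _ _ (nbhs t)) => j; exact: nbP.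
by apply: (filterS _ nbP_all) => s Ps; exact: sPA.
Qed.

Lemma simplex_map_continuous p q (f : 'I_p.+1 -> 'I_q.+1) :
  continuous (@simplex_map p q f).
Proof.
apply: continuous_comp_initial => t.
apply: (@continuous_comp _ _ _ (set_val : set_type (@simplex p) -> _)
  (simplex_fun f)); last exact: simplex_fun_continuous.
exact: initial_continuous.
Qed.

Variable M : topologicalType.

Definition sing (q : nat) : Type :=
  {s : set_type (@simplex q) -> M | continuous s}.

Lemma sing_map_continuous p q (f : 'I_p.+1 -> 'I_q.+1) (s : sing q) :
  continuous (sval s \o simplex_map f).
Proof.
move=> t; apply: continuous_comp; first exact: simplex_map_continuous.
exact: (svalP s).
Qed.

Definition sing_map p q (f : 'I_p.+1 -> 'I_q.+1) (s : sing q) : sing p :=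
  exist _ (sval s \o simplex_map f) (@sing_map_continuous _ _ f s).

Definition face q (i : 'I_q.+2) : sing q.+1 -> sing q := sing_map (lift i).

Variable k : comPzRingType.

Definition cochain (q : nat) : Type := sing q -> k.

Definition coboundary q (f : cochain q) : cochain q.+1 :=
  fun s => \sum_(i < q.+2) (-1) ^+ i * f (face i s).

Definition cocycle q (f : cochain q) : Prop := forall s, coboundary f s = 0.

Definition is_coboundary q : cochain q -> Prop :=
  match q with
  | 0 => fun f => forall s, f s = 0
  | q'.+1 => fun f => exists g : cochain q', forall s, f s = coboundary g s
  end.

Definition cup p q (f : cochain p) (g : cochain q) : cochain (p + q) :=
  fun s => f (sing_map (fun i : 'I_p.+1 => inord i) s)
           * g (sing_map (fun j : 'I_q.+1 => inord (p + j)) s).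

(* A chain is a formal sum, written as a list of terms [(c, s)] for [c * s].
   Lists are never compared by [=], only through their values on cochains,
   which determine their coefficients: see [chain_eq]. *)
Definition chain (q : nat) : Type := seq (k * sing q).

Definition ceval q (f : cochain q) (c : chain q) : k :=
  \sum_(x <- c) x.1 * f x.2.

Definition cscale q (r : k) (c : chain q) : chain q :=
  [seq (r * x.1, x.2) | x <- c].

Definition boundary q : chain q -> chain q.-1 :=
  match q with
  | 0 => fun=> [::]
  | q'.+1 => fun c =>
      [seq ((-1) ^+ i * x.1, face i x.2) | x <- c, i : 'I_q'.+2 <- enum 'I_q'.+2]
  end.

(* Equality in the relative chain group [C_q(M, M \ B; k)]; for [B = setT]
   this is equality in [C_q(M; k)]. *)
Definition chain_eq q (B : set M) (c c' : chain q) : Prop :=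
  forall f : cochain q,
    (forall s : sing q, (forall t, ~ B (sval s t)) -> f s = 0) ->
    ceval f c = ceval f c'.

Definition rel_cycle q (B : set M) (c : chain q) : Prop :=
  chain_eq B (boundary c) [::].

Definition rel_homologous q (B : set M) (c c' : chain q) : Prop :=
  exists w : chain q.+1, chain_eq B c (c' ++ boundary w).

Definition locally_euclidean (m : nat) : Prop :=
  forall x : M, exists (U : set M) (V : set 'rV[R]_m)
      (phi : M -> 'rV[R]_m) (psi : 'rV[R]_m -> M),
    [/\ open U /\ U x, open V,
        (forall y, U y -> V (phi y) /\ psi (phi y) = y),
        (forall v, V v -> U (psi v) /\ phi (psi v) = v) &
        {in U, continuous phi} /\ {in V, continuous psi}].

Definition compact_connected_manifold (m : nat) : Prop :=
  [/\ hausdorff_space M /\ @second_countable M, locally_euclidean m,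
      compact [set: M], [set: M] !=set0 & connected [set: M]].

(* The cycle [c] represents a generator of [H_m(M, M \ x; k)], a free
   module of rank one. *)
Definition local_generator m (x : M) (c : chain m) : Prop :=
  rel_cycle [set x] c /\
  forall z : chain m, rel_cycle [set x] z ->
    exists r : k, rel_homologous [set x] z (cscale r c).

Definition k_orientation m (mu : M -> chain m) : Prop :=
  (forall x, local_generator x (mu x)) /\
  (forall x : M, exists (B : set M) (c : chain m),
     [/\ nbhs x B, rel_cycle B c &
         forall y, B y -> rel_homologous [set y] c (mu y)]).

Definition fundamental_cycle m (mu : M -> chain m) (z : chain m) : Prop :=
  rel_cycle setT z /\ forall x, rel_homologous [set x] z (mu x).
End Singular.

(* The homogeneous basis serves to construct the tensor powers of the algebra;
   [gdeg i] is the degree of [gbasis i]. *)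
Record graded_algebra (k : comPzRingType) := GradedAlgebra {
  galg :> algType k;
  grank : nat;
  gdeg : 'I_grank -> nat;
  gbasis : 'I_grank -> galg;
  gcoord : 'I_grank -> {linear galg -> k^o};
  gcoord_basis : forall i j, gcoord i (gbasis j) = (i == j)%:R;
  gbasis_coord : forall a, a = \sum_i gcoord i a *: gbasis i }.

Section Frobenius.
Variables (k : comPzRingType) (A : graded_algebra k).

(* [homog d] is the component [A^d]. *)
Definition homog (d : nat) (a : A) : Prop :=
  forall i, gcoord i a != 0 -> gdeg i = d.

Record frobenius (m : nat) (pairing : A -> A -> k) : Prop := {
  frob_grading : forall d e (a b : A),
    homog d a -> homog e b -> homog (d + e) (a * b);
  frob_deg0 : forall a : A, homog 0 a <-> exists c : k, a = c%:A;
  frob_deg0_inj : forall c : k, c%:A = 0 :> A -> c = 0;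
  frob_comm : forall d e (a b : A),
    homog d a -> homog e b -> a * b = (-1) ^+ (d * e) *: (b * a);
  frob_linear_l : forall c (a a' b : A),
    pairing (c *: a + a') b = c * pairing a b + pairing a' b;
  frob_linear_r : forall c (a b b' : A),
    pairing a (c *: b + b') = c * pairing a b + pairing a b';
  frob_degree : forall d e (a b : A),
    homog d a -> homog e b -> (d + e)%N <> m -> pairing a b = 0;
  frob_sym : forall d e (a b : A),
    homog d a -> homog e b -> pairing a b = (-1) ^+ (d * e) * pairing b a;
  frob_assoc : forall a b c : A, pairing (a * b) c = pairing a (b * c);
  frob_perfect : forall phi : {linear A -> k^o},
    exists! a : A, forall b, pairing a b = phi b }.

(* [A], with [cl] sending a cocycle to its class, is [H^*(M; k)] with the cup
   product, and [pairing] is the Poincare pairing of the oriented manifold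
   [(M, mu)] of dimension [m]. *)
Record cohomology_algebra (R : realType) (M : topologicalType) (m : nat)
    (mu : M -> @chain R M k m) (cl : forall q, @cochain R M k q -> A)
    (pairing : A -> A -> k) : Prop := {
  coh_linear : forall q (c : k) (f g : cochain R M k q), cocycle f -> cocycle g ->
    cl q (fun s => c * f s + g s) = c *: cl q f + cl q g;
  coh_homog : forall q (f : cochain R M k q), cocycle f -> homog q (cl q f);
  coh_surj : forall q (a : A), homog q a ->
    exists f : cochain R M k q, cocycle f /\ cl q f = a;
  coh_kernel : forall q (f : cochain R M k q), cocycle f ->
    (cl q f = 0 <-> is_coboundary f);
  coh_one : cl 0 (fun=> 1) = 1;
  coh_cup : forall p q (f : cochain R M k p) (g : cochain R M k q),
    cocycle f -> cocycle g -> cl (p + q)%N (cup f g) = cl p f * cl q g;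
  coh_pairing : forall z, fundamental_cycle mu z ->
    forall (a b : A) (h : cochain R M k m), cocycle h -> a * b = cl m h ->
    pairing a b = ceval h z }.

(* [A^{(x) n}], as the free module on the words [w] of length [n] in the
   basis of [A]; [w] stands for [gbasis (w 0) (x) ... (x) gbasis (w (n-1))]. *)
Definition word (n : nat) : finType := {ffun 'I_n -> 'I_(grank A)}.
Definition tens (n : nat) : lmodType k := {ffun word n -> k^o}.

Definition wdeg n (w : word n) : nat := (\sum_i gdeg (w i))%N.

(* [a 0 (x) ... (x) a (n-1)] *)
Definition tensor n (a : 'I_n -> A) : tens n :=
  [ffun w : word n => \prod_i gcoord (w i) (a i)].

Definition koszul n (u v : word n) : nat :=
  (\sum_(i < n) \sum_(j < n | j < i) gdeg (u i) * gdeg (v j))%N.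

Definition tmul n (x y : tens n) : tens n :=
  \sum_(u : word n) \sum_(v : word n) (x u * y v * (-1) ^+ koszul u v) *:
    tensor (fun i => gbasis (u i) * gbasis (v i)).

Definition tone n : tens n := tensor (fun=> 1).

(* [a[i]] *)
Definition tinj n (i : 'I_n) (a : A) : tens n :=
  tensor (fun j => if j == i then a else 1).

(* [p_{i,j}^*] *)
Definition tpull n (i j : 'I_n) (x : tens 2) : tens n :=
  \sum_(w : word 2) x w *:
    tmul (tinj i (gbasis (w ord0))) (tinj j (gbasis (w ord_max))).

Definition tensor2 (a b : A) : tens 2 :=
  tensor (fun i => if i == ord0 then a else b).

Definition pairing2 (pairing : A -> A -> k) (x y : tens 2) : k :=
  \sum_(u : word 2) \sum_(v : word 2)
    x u * y v * (-1) ^+ (gdeg (u ord_max) * gdeg (v ord0)) *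
    (pairing (gbasis (u ord0)) (gbasis (v ord0)) *
     pairing (gbasis (u ord_max)) (gbasis (v ord_max))).

Definition diagonal_class (pairing : A -> A -> k) (Delta : tens 2) : Prop :=
  forall a b : A, pairing2 pairing (tensor2 a b) Delta = pairing (a * b) 1.
End Frobenius.

(* The chosen order of the edges is that of ['I_esize]. Parallel edges are
   allowed; loops are not: a loop [e] at [i] would give
   [delta (G_e (x) 1) = 1] in [C_BS] but [d G_e = p_{i,i}^* Delta] in [R]. *)
Record graph (n : nat) := Graph {
  esize : nat;
  esrc : 'I_esize -> 'I_n;
  etgt : 'I_esize -> 'I_n;
  esrc_etgt : forall e, (esrc e < etgt e)%N;
  edge_lexicographic : forall e f : 'I_esize, (e < f)%N ->
    (esrc e < esrc f)%N \/ esrc e = esrc f /\ (etgt e <= etgt f)%N }.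

Section Graphs.
Variables (n : nat) (G : graph n).

Definition edge : finType := 'I_(esize G).

Definition joins (e : edge) (i j : 'I_n) : bool :=
  ((esrc e == i) && (etgt e == j)) || ((esrc e == j) && (etgt e == i)).

(* [l(S)] *)
Definition ncomp (S : {set edge}) : nat :=
  n_comp [rel i j | [exists e in S, joins e i j]] predT.

(* The number of edges of [S] preceding [e]. *)
Definition epos (e : edge) (S : {set edge}) : nat :=
  #|[set f in S | (f < e)%N]|.

Definition external (S : {set edge}) (e : edge) : bool :=
  ncomp (S :\ e) != ncomp S.
Definition r_ext (S : {set edge}) : nat := #|[set e in S | external S e]|.
Definition r_int (S : {set edge}) : nat := #|[set e in S | ~~ external S e]|.
End Graphs.

(* The two-sided ideal generated by [gens] for the product [mul]. *)
Inductive ideal (k : pzRingType) (V : lmodType k) (mul : V -> V -> V)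
    (gens : V -> Prop) : V -> Prop :=
  | ideal_gen x : gens x -> ideal mul gens x
  | ideal0 : ideal mul gens 0
  | idealD x y : ideal mul gens x -> ideal mul gens y -> ideal mul gens (x + y)
  | idealZ c x : ideal mul gens x -> ideal mul gens (c *: x)
  | ideal_mull x y : ideal mul gens y -> ideal mul gens (mul x y)
  | ideal_mulr x y : ideal mul gens x -> ideal mul gens (mul x y).

Section Complexes.
Variables (k : comPzRingType) (A : graded_algebra k) (m : nat).
Variables (n : nat) (G : graph n).

(* The free module [(+)_S G_S (x) A^{(x) n}] over all sets of edges [S], that
   is, [Lambda[G_e] (x) A^{(x) n}]; [gterm S x] is [G_S (x) x]. *)
Definition pre : lmodType k := {ffun {set edge G} -> tens A n}.

Definition gterm (S : {set edge G}) (x : tens A n) : pre :=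
  [ffun T : {set edge G} => if T == S then x else 0].

(* The ideal of [A^{(x) n}] whose quotient is [A_S]. *)
Definition A_ideal (S : {set edge G}) : tens A n -> Prop :=
  ideal (@tmul k A n)
    (fun y => exists a (e : edge G), e \in S /\
       y = tinj (esrc e) a - tinj (etgt e) a).

Definition BS_zero (p : pre) : Prop := forall S, A_ideal S (p S).

Lemma BS_zero0 : BS_zero 0.
Proof.
move=> S; have -> : (0 : pre) S = 0 by exact: ffunE.
exact: ideal0.
Qed.

Lemma BS_zeroD p q : BS_zero p -> BS_zero q -> BS_zero (p + q).
Proof.
move=> Ip Iq S; have -> : (p + q) S = p S + q S by exact: ffunE.
exact: idealD (Ip S) (Iq S).
Qed.

Lemma BS_zeroZ c p : BS_zero p -> BS_zero (c *: p).
Proof.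
move=> Ip S; have -> : (c *: p) S = c *: p S by exact: ffunE.
exact: idealZ (Ip S).
Qed.

Definition BS_submodule : submodule pre :=
  Submodule BS_zero0 BS_zeroD BS_zeroZ.

(* [(+)_S G_S (x) A_S], as the quotient of [(+)_S G_S (x) A^{(x) n}]; an
   element of [A^{(x) n}] is a lift of its class in [A_S]. *)
Definition C_BS : lmodType k := quotmod BS_submodule.
Definition BS_class (p : pre) : C_BS := cls BS_submodule p.

Definition BS_differential (Delta : tens A 2) (delta : {linear C_BS -> C_BS}) :
  Prop :=
  forall (S : {set edge G}) (x : tens A n),
    delta (BS_class (gterm S x)) =
    \sum_(e in S) (-1) ^+ epos e S *:
      BS_class (gterm (S :\ e)
        (if ncomp (S :\ e) == ncomp S then x
         else tmul (tpull (esrc e) (etgt e) Delta) x)).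

(* Internal and external edges are relative to [S] itself, so removing an
   internal edge can turn other internal edges into external ones. *)
Definition BS_degree (S : {set edge G}) (w : word A n) : int :=
  (m%:Z - 1) * (r_ext S)%:Z - (r_int S)%:Z + (wdeg w)%:Z.

(* The number of pairs of edges [f < e] with [e] in [S] and [f] in [T]. *)
Definition einv (S T : {set edge G}) : nat := (\sum_(e in S) epos e T)%N.

(* [(-1)^(d |x|) x] for homogeneous [x]. *)
Definition twist (d : int) (x : tens A n) : tens A n :=
  [ffun w : word A n => (-1) ^+ absz (d * (wdeg w)%:Z) * x w].

(* The product of [Lambda[G_e] (x) A^{(x) n}]: the Koszul sign comes from
   moving [x] past [G_T], of degree [(m - 1) |T|], in [G_S x G_T y]. *)
Definition pmul (p q : pre) : pre :=
  \sum_(S : {set edge G}) \sum_(T : {set edge G} | [disjoint S & T]) (-1) ^+ einv S T *: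
    gterm (S :|: T) (tmul (twist ((m%:Z - 1) * #|T|%:Z) (p S)) (q T)).

Definition pone : pre := gterm finset.set0 (tone A n).
Definition gedge (e : edge G) : pre := gterm [set e] (tone A n).
Definition pin (x : tens A n) : pre := gterm finset.set0 x.

(* In [rel_sym], as in [rel_arnold], the generator of an edge depends only on
   its pair of endpoints. *)
Inductive R_relation : pre -> Prop :=
  | rel_sym e f : esrc e = esrc f -> etgt e = etgt f ->
      R_relation (gedge e - gedge f)
  | rel_move e a :
      R_relation (pmul (pin (tinj (esrc e) a)) (gedge e)
                  - pmul (pin (tinj (etgt e) a)) (gedge e))
  | rel_arnold c (v : 'I_c -> 'I_n) (e : 'I_c -> edge G) :
      (3 <= c)%N -> injective v ->
      (forall i, joins (e i) (v i) (v (ordS i))) ->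
      R_relation (\sum_(i < c) (-1) ^+ i *:
        \big[pmul/pone]_(j < c | j != i) gedge (e j)).

Definition R_submodule : submodule pre :=
  Submodule (@ideal0 _ _ pmul R_relation) (@idealD _ _ pmul R_relation)
    (@idealZ _ _ pmul R_relation).

Definition R_alg : lmodType k := quotmod R_submodule.
Definition R_class (p : pre) : R_alg := cls R_submodule p.
Definition R_mul (q r : R_alg) : R_alg := R_class (pmul (rep q) (rep r)).

Definition R_degree (S : {set edge G}) (w : word A n) : int :=
  (m%:Z - 1) * #|S|%:Z + (wdeg w)%:Z.

Definition pre_homog (deg : {set edge G} -> word A n -> int) (d : int)
  (p : pre) : Prop := forall S w, p S w != 0 -> deg S w = d.

Record R_differential (Delta : tens A 2) (d : {linear R_alg -> R_alg}) : Prop := {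
  R_diff_A : forall x, d (R_class (pin x)) = 0;
  R_diff_G : forall e, d (R_class (gedge e)) =
    R_class (pin (tpull (esrc e) (etgt e) Delta));
  R_diff_leibniz : forall i p (r : R_alg), pre_homog R_degree i p ->
    d (R_mul (R_class p) r) = R_mul (d (R_class p)) r
      + (-1) ^+ absz i *: R_mul (R_class p) (d r) }.
End Complexes.

Record quasi_equivalence (k : pzRingType) (C D : lmodType k)
    (dC : C -> C) (dD : D -> D) (F : C -> D) : Prop := {
  qe_complexC : forall x, dC (dC x) = 0;
  qe_complexD : forall y, dD (dD y) = 0;
  qe_chain : forall x, F (dC x) = dD (F x);
  qe_inj : forall x, dC x = 0 -> (exists y, F x = dD y) -> exists z, x = dC z;
  qe_surj : forall y, dD y = 0 ->
    exists x, dC x = 0 /\ exists z, y = F x + dD z }.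

(* Main.v *)
(* The relations of R say that the kernel of (+)_S G_S (x) A^{(x) n} -> R is
   spanned by the G_S (x) x with x = 0 in A_S, the G_S (x) x with S containing a
   circuit, and the D(G_S) (x) x with S containing a circuit, where D is the
   derivation of the exterior algebra with D(G_e) = 1.  Modulo terms supported
   on cyclic sets, D(G_S) (x) x agrees with delta(G_S (x) x); so the kernel of F
   is K + delta K, where K is the span of the G_S (x) A_S with S cyclic.  Since
   delta^2 = 0, F is a quasi-isomorphism as soon as every cocycle of K is the
   coboundary of an element of K.  Call e active for S if the ends of e are
   connected by the edges f > e of S.  Adding e to the sets for which it is
   active is a contraction of delta up to terms for which e is no longer active;
   applying it for e = 0, 1, 2, ... moves a cocycle of K, modulo delta K, into
   the span of the cyclic sets with no active edge, and there are none. *)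
Require Import Defs.
From HB Require Import structures.
From mathcomp Require Import all_boot all_order all_algebra.
From mathcomp Require Import all_classical reals topology.
From mathcomp Require Import zify.
Import fintype fingraph boot.finset.

Set Implicit Arguments.
Unset Strict Implicit.
Unset Printing Implicit Defensive.

Import GRing.Theory.

Local Open Scope ring_scope.

(** * Edge sets: connectivity and circuits *)

Section Connectivity.
Local Open Scope nat_scope.
Variables (n : nat) (G : graph n).
Implicit Types (S T : {set edge G}) (e f : edge G) (x y : 'I_n).

(** [K] itself is not a subcomplex: removing an edge from a set with a single circuit can leave a
    forest, where [F] is not zero. This is why [delta K] has to be added to it. The contractions for
    successive edges must not undo each other. When [e] is active for [S], its ends are already
    joined by larger edges, so adding [e] creates no new connection among the edges above any
    [f < e]; activity below [e] is therefore unaffected. If [S] is cyclic, the enlarged set has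
    Betti number at least two, so each term of its coboundary is still cyclic. The contractions have
    coefficients 0, 1 and -1 only, which makes the argument valid over every [k]. Evenness of [m]
    makes [Delta] even and invariant under exchange of its factors, as [delta^2 = 0] requires when
    two edges disconnect only jointly; it also makes [G_e] odd, so that [d] has the signs of
    [delta]. Parallel edges give circuits of length two, which the Arnold relations leave out; for
    these, the identification of generators with the same ends takes the place of an Arnold
    relation. *)

Definition adj S : rel 'I_n := [rel i j | [exists e in S, joins e i j]].
Definition conn S : rel 'I_n := connect (adj S).
(** These are not the bridges of graph theory: for [e] in [S], [bridged (S :\ e) e] says that [e] is
    internal in [S]; for [e] outside [S], [bridged S e] says that adding [e] closes a circuit. *)
Definition bridged S e : bool := conn S (esrc e) (etgt e).

Lemma joinsC e x y : joins e x y = joins e y x.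
Proof. by rewrite /joins orbC. Qed.

Lemma joins_ends e : joins e (esrc e) (etgt e).
Proof. by rewrite /joins !eqxx. Qed.

Lemma adjP S x y : reflect (exists2 e, e \in S & joins e x y) (adj S x y).
Proof. exact: exists_inP. Qed.

Lemma conn0 S x : conn S x x.
Proof. exact: connect0. Qed.

Lemma adj_sym S : symmetric (adj S).
Proof. by move=> x y; apply: eq_existsb => e; rewrite joinsC. Qed.

Lemma connC S x y : conn S x y = conn S y x.
Proof. exact: (sym_connect_sym (@adj_sym S)). Qed.

Lemma conn_trans S : transitive (conn S).
Proof. exact: connect_trans. Qed.

Lemma conn_sub S T : S \subset T -> subrel (conn S) (conn T).
Proof.
move=> /subsetP sST; apply: connect_sub => x y /adjP[e Se exy].
by apply/connect1/adjP; exists e => //; apply: sST.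
Qed.

Lemma bridged_sub S T e : S \subset T -> bridged S e -> bridged T e.
Proof. by move=> sST; apply: conn_sub. Qed.

Lemma bridged_mem S e : e \in S -> bridged S e.
Proof. by move=> Se; apply/connect1/adjP; exists e => //; apply: joins_ends. Qed.

Lemma conn_joins S e x y : e \in S -> joins e x y -> conn S x y.
Proof. by move=> Se exy; apply/connect1/adjP; exists e. Qed.

(** A walk can be shortened so as to pass through [e] at most once, in one of two directions. *)
Lemma conn_setU1 S e x y : conn (e |: S) x y =
  [|| conn S x y, conn S x (esrc e) && conn S (etgt e) y
    | conn S x (etgt e) && conn S (esrc e) y].
Proof.
have eT : e \in e |: S by rewrite !inE eqxx.
have sST : S \subset e |: S by rewrite subsetUr.
apply/idP/idP => [/connectP[p]|].
  elim: p x => [|z p IHp] x /=; first by move=> _ ->; rewrite conn0.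
  move=> /andP[/adjP[f]]; rewrite !inE => /orP[/eqP->|Sf] fxz pz ly.
    have := IHp z pz ly; move: fxz; rewrite /joins.
    case/orP => /andP[/eqP<- /eqP<-]; case/or3P => [->|/andP[_ ->]|/andP[_ ->]];
    by rewrite ?conn0 ?orbT.
  have cxz : conn S x z := conn_joins Sf fxz.
  case/or3P: (IHp z pz ly) => [zy|/andP[zs ->]|/andP[zs ->]].
  - by rewrite (conn_trans cxz zy).
  - by rewrite (conn_trans cxz zs) orbT.
  - by rewrite (conn_trans cxz zs) !orbT.
have eb : bridged (e |: S) e by apply: bridged_mem.
case/or3P => [|/andP[xs sy]|/andP[xs sy]]; first exact: conn_sub.
  exact: (conn_trans (conn_sub sST xs) (conn_trans eb (conn_sub sST sy))).
apply: (conn_trans (conn_sub sST xs) (conn_trans _ (conn_sub sST sy))).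
by rewrite connC.
Qed.

Lemma conn_setU1_bridged S e : bridged S e -> conn (e |: S) =2 conn S.
Proof.
move=> eb x y; rewrite conn_setU1; apply/or3P/idP => [|->]; last by constructor.
case=> // /andP[xs sy].
  exact: conn_trans xs (conn_trans eb sy).
by apply: conn_trans xs (conn_trans _ sy); rewrite connC.
Qed.

(** Components that avoid both ends of [e] are common to the two graphs. The rest is the closure [a]
    of the two ends: one component with [e], one or two without it. *)
Lemma ncomp_setU1 S e : ncomp S = ncomp (e |: S) + ~~ bridged S e.
Proof.
set T := e |: S; have sym R := sym_connect_sym (@adj_sym R).
pose a : {pred 'I_n} := closure (adj S) (pred2 (esrc e) (etgt e)).
have in_a R x : (x \in closure (adj R) (pred2 (esrc e) (etgt e))) =
    conn R x (esrc e) || conn R x (etgt e).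
  apply/existsP/orP => [[y /andP[/= xy]]|[] xy].
  - by rewrite !inE => /orP[/eqP<-|/eqP<-]; [left|right].
  - by exists (esrc e); apply/andP; split; [exact: xy | rewrite !inE eqxx].
  - by exists (etgt e); apply/andP; split; [exact: xy | rewrite !inE eqxx orbT].
have aT : a =i closure (adj T) (pred2 (esrc e) (etgt e)).
  move=> x; rewrite !in_a !conn_setU1 !conn0 !andbT.
  by rewrite -/(conn S); do 2?case: (conn S x _); rewrite ?orbT //.
rewrite /ncomp (n_compC a (adj S)) (n_compC a (adj T)).
rewrite (n_comp_closure2 (sym S)) (eq_n_comp_r aT) (n_comp_closure2 (sym T)).
have -> : connect (adj T) (esrc e) (etgt e) by apply: bridged_mem; rewrite !inE eqxx.
have -> : n_comp (adj T) [predC a] = n_comp (adj S) [predC a].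
  apply: eq_card => x; rewrite [LHS]inE [RHS]inE /=.
  rewrite !inE; case: (boolP (x \in a)) => [_|xa]; first by rewrite !andbF.
  (* The root of [x] is what [pick] finds in its component, so equal components have equal roots. *)
  rewrite !andbT /roots /root; congr (odflt _ _ == _).
  apply: eq_pick => y; rewrite -!/(conn _ _ _) conn_setU1.
  move: xa; rewrite in_a negb_or => /andP[/negPf-> /negPf->].
  by rewrite orbF.
by rewrite /bridged /conn; case: connect => /=; lia.
Qed.

Lemma ncomp_setD1 S e : e \in S -> ncomp (S :\ e) = ncomp S + ~~ bridged (S :\ e) e.
Proof. by move=> Se; rewrite (ncomp_setU1 (S :\ e) e) setD1K. Qed.

Lemma ncomp_setD1_eq S e : e \in S ->
  (ncomp (S :\ e) == ncomp S) = bridged (S :\ e) e.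
Proof. by move=> Se; rewrite ncomp_setD1 //; case: bridged => /=; lia. Qed.

Lemma ncomp0 : ncomp (finset.set0 : {set edge G}) = n.
Proof.
rewrite /ncomp /n_comp_mem -[RHS]card_ord; apply: eq_card => x.
rewrite !inE andbT /roots; apply/eqP.
have /connectP[[|y p] /=] := connect_root (adj finset.set0) x; first by move=> _ ->.
by case/andP => /adjP[f]; rewrite inE.
Qed.

(* [|S| + ncomp S - n] is the first Betti number of the graph [[G : S]]. *)
Definition cyclic S : bool := n < #|S| + ncomp S.

Lemma cardD1S S e : e \in S -> #|S| = #|S :\ e|.+1.
Proof. by move=> Se; rewrite (cardsD1 e) Se. Qed.

Lemma cyclicD1 S e : e \in S -> ~~ bridged (S :\ e) e ->
  cyclic S = cyclic (S :\ e).
Proof.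
by move=> Se /negbTE eb; rewrite /cyclic ncomp_setD1 // eb (cardD1S Se) /= addn1 addnS.
Qed.

(** Equality holds for the empty set, and removing an edge lowers the sum by one or leaves it
    unchanged. *)
Lemma betti_ge0 S : n <= #|S| + ncomp S.
Proof.
move: {-1}#|S| (eqxx #|S|) => c; elim: c S => [|c IHc] S cS.
  by move: cS; rewrite cards_eq0 => /eqP->; rewrite ncomp0 leq_addl.
have /card_gt0P[e Se] : 0 < #|S| by rewrite (eqP cS).
have cSe : #|S :\ e| = c by move: cS; rewrite (cardD1S Se) => /eqP [->].
have := IHc (S :\ e); rewrite cSe eqxx => /(_ isT).
by rewrite ncomp_setD1 //; case: bridged => /=; lia.
Qed.

Lemma bridged_cyclic S e : e \in S -> bridged (S :\ e) e -> cyclic S.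
Proof.
move=> Se eb; have := betti_ge0 (S :\ e).
by rewrite /cyclic ncomp_setD1 // eb addn0 (cardD1S Se) addSn.
Qed.

Lemma cyclic_setU1 S e : e \notin S -> bridged S e -> cyclic (e |: S).
Proof.
move=> nSe eb; apply: (@bridged_cyclic _ e); first by rewrite !inE eqxx.
by rewrite setU1K.
Qed.

Lemma cyclic_sub S T : S \subset T -> cyclic S -> cyclic T.
Proof.
move: {-1}#|T| (eqxx #|T|) => c; elim: c T => [|c IHc] T cT sST cS.
  move: cT sST; rewrite cards_eq0 => /eqP->; rewrite subset0 => /eqP E.
  by rewrite E in cS.
have [E|] := eqVneq S T; first by rewrite -E.
move=> neST; have /properP[_ [e Te nSe]] : S \proper T by rewrite properEneq neST.
have [eb|neb] := boolP (bridged (T :\ e) e); first exact: bridged_cyclic eb.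
rewrite (cyclicD1 Te neb); apply: IHc => //; last by rewrite subsetD1 sST.
by move: cT; rewrite (cardD1S Te).
Qed.

(** [C] is a minimal cyclic subset. An external edge could be removed from it without destroying
    cyclicity, so all its edges are internal. *)
Lemma cyclic_circuit S : cyclic S -> exists2 C : {set edge G}, C \subset S &
  (exists e, e \in C) /\ forall e, e \in C -> bridged (C :\ e) e.
Proof.
move: {-1}#|S| (leqnn #|S|) => c; elim: c S => [|c IHc] S.
  by rewrite leqn0 cards_eq0 => /eqP->; rewrite /cyclic cards0 ncomp0 ltnn.
move=> cS Sc; case: (pickP [pred e in S | cyclic (S :\ e)]) => [e /=/andP[Se Sec]|noe].
  have cSe : #|S :\ e| <= c by move: cS; rewrite (cardD1S Se).
  have [C sCS HC] := IHc _ cSe Sec; exists C => //.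
  exact: subset_trans sCS (subD1set _ _).
exists S => //; split=> [|e Se].
  apply/set0Pn; apply: contraTneq Sc => ->.
  by rewrite /cyclic cards0 ncomp0 ltnn.
apply: contraFT (noe e) => neb; by rewrite /= Se -(cyclicD1 Se neb).
Qed.

(** Removing the two edges in either order must produce the same number of components. Either
    neither edge changes the status of the other, or both are internal in [S] and each becomes
    external once the other is gone. *)
Lemma bridged_swap S e f : e \in S -> f \in S -> e != f ->
  [/\ bridged (S :\ e :\ f) f = bridged (S :\ f) f &
      bridged (S :\ e :\ f) e = bridged (S :\ e) e] \/
  [/\ bridged (S :\ e :\ f) f = false, bridged (S :\ e :\ f) e = false,
      bridged (S :\ f) f & bridged (S :\ e) e].
Proof.
move=> Se Sf ef; have Sef : f \in S :\ e by rewrite !inE eq_sym ef.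
have Sfe : e \in S :\ f by rewrite !inE ef.
have UC : S :\ f :\ e = S :\ e :\ f by apply/setP => g; rewrite !inE andbCA.
have := ncomp_setD1 Sef; have := ncomp_setD1 Sfe; rewrite UC.
rewrite (ncomp_setD1 Se) (ncomp_setD1 Sf); set U := S :\ e :\ f.
have Ue : U \subset S :\ e by apply: subD1set.
have Uf : U \subset S :\ f by rewrite /U -UC; apply: subD1set.
have := @bridged_sub _ _ e Ue; have := @bridged_sub _ _ f Uf.
case: (bridged U f); case: (bridged U e); case: (bridged (S :\ e) e);
  case: (bridged (S :\ f) f) => //= h1 h2 h3 h4;
  solve [by left | by right | by have := h1 isT | by have := h2 isT | lia].
Qed.

(* [e] closes a broken circuit of [S], or is the least edge of a circuit of [S]. *)
Definition active S e : bool := bridged [set f in S | e < f] e.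

Lemma active_sub S T e : S \subset T -> active S e -> active T e.
Proof.
move=> sST; apply: bridged_sub; apply/subsetP => f.
by rewrite !inE => /andP[/(subsetP sST)-> ->].
Qed.

Lemma active_toggle S e : active (e |: S) e = active S e.
Proof.
congr (bridged _ _); apply/setP => f; rewrite !inE.
by case: eqP => //= ->; rewrite ltnn andbF.
Qed.

Lemma active_bridged S e : active S e -> bridged (S :\ e) e.
Proof.
apply: bridged_sub; apply/subsetP => f; rewrite !inE => /andP[-> ef].
by rewrite andbT; apply: contraTneq ef => ->; rewrite ltnn.
Qed.

(** The ends of [e] are joined by edges of [S] above [e], hence above [f]; so [e] adds no connection
    to the edges above [f]. *)
Lemma active_setU1 S e f : f < e -> active S e -> active (e |: S) f -> active S f.
Proof.
move=> fe Se; rewrite /active /bridged.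
have -> : [set g in e |: S | f < g] = e |: [set g in S | f < g].
  by apply/setP => g; rewrite !inE; case: (eqVneq g e) => [->|].
rewrite conn_setU1_bridged //; apply: bridged_sub Se.
apply/subsetP => g; rewrite !inE => /andP[-> eg]; exact: ltn_trans fe eg.
Qed.

(** In a minimal cyclic subset, the least edge has its ends joined by the other edges, all of them
    larger. *)
Lemma cyclic_active S : cyclic S -> exists e, active S e.
Proof.
case/cyclic_circuit => C sCS [[e0 Ce0] HC].
case: (arg_minnP (fun e : edge G => e : nat) Ce0) => e Ce emin.
exists e; apply: (active_sub sCS); move: (HC e Ce).
apply: bridged_sub; apply/subsetP => f; rewrite !inE => /andP[fe Cf].
by rewrite Cf /= ltn_neqAle (emin f Cf) andbT eq_sym.
Qed.
End Connectivity.

Lemma prod_neq0 (R : comPzRingType) (I : finType) (F : I -> R) (i : I) :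
  \prod_j F j != 0 -> F i != 0.
Proof. by apply: contra_neq => Fi0; rewrite (bigD1 i) //= Fi0 mul0r. Qed.

Lemma sign_parity (R : pzRingType) a b :
  odd a = odd b -> (-1) ^+ a = (-1) ^+ b :> R.
Proof. by rewrite -(signr_odd _ a) -(signr_odd _ b) => ->. Qed.

(** * Tensor powers of a graded algebra *)

Section TensorPowers.
Variables (k : comPzRingType) (A : graded_algebra k) (n : nat).
Implicit Types (x y z : tens A n) (u v w : word A n) (c : k).

Lemma tensP x y : (forall w, x w = y w) -> x = y.
Proof. by move=> E; apply/ffunP. Qed.

Lemma tens0E w : (0 : tens A n) w = 0. Proof. exact: ffunE. Qed.
Lemma tensDE x y w : (x + y) w = x w + y w. Proof. exact: ffunE. Qed.
Lemma tensZE c x w : (c *: x) w = c * x w. Proof. exact: ffunE. Qed.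
Lemma tens_sumE I (r : seq I) (P : pred I) (F : I -> tens A n) w :
  (\sum_(i <- r | P i) F i) w = \sum_(i <- r | P i) F i w.
Proof. by elim/big_rec2: _ => [|i ? ? _ <-]; rewrite ?tens0E ?tensDE. Qed.

Lemma tensorE (a : 'I_n -> A) w : tensor a w = \prod_i gcoord (w i) (a i).
Proof. exact: ffunE. Qed.

Lemma eq_tensor (a b : 'I_n -> A) : a =1 b -> tensor a = tensor b.
Proof. by move=> E; apply: tensP => w; rewrite !tensorE; apply: eq_bigr => i _; rewrite E. Qed.

Definition wtens w : tens A n := tensor (fun i => gbasis (w i)).

Lemma wtensE w v : wtens w v = (v == w)%:R.
Proof.
rewrite tensorE; case: (eqVneq v w) => [->|].
  by rewrite big1 // => i _; rewrite gcoord_basis eqxx.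
move/eqP/ffunP => ne; have /existsP[i nei] : [exists i, v i != w i].
  by rewrite -negb_forall; apply/forallP => E; apply: ne => i; apply/eqP.
by rewrite (bigD1 i) //= gcoord_basis (negbTE nei) mul0r.
Qed.

Lemma tens_expand x : x = \sum_w x w *: wtens w.
Proof.
apply: tensP => v; rewrite tens_sumE (bigD1 v) //= tensZE wtensE eqxx mulr1.
rewrite big1 ?addr0 // => w ne; rewrite tensZE wtensE eq_sym (negbTE ne).
by rewrite mulr0.
Qed.

Lemma tens_ind (P : tens A n -> Prop) :
  P 0 -> (forall c x y, P x -> P y -> P (c *: x + y)) ->
  (forall w, P (wtens w)) -> forall x, P x.
Proof.
move=> P0 PD Pw x; rewrite [x]tens_expand.
by elim/big_rec: _ => // w y _; apply: PD.
Qed.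

Lemma tmulPl c x x' y : tmul (c *: x + x') y = c *: tmul x y + tmul x' y.
Proof.
rewrite /tmul scaler_sumr -big_split; apply: eq_bigr => u _ /=.
rewrite scaler_sumr -big_split; apply: eq_bigr => v _ /=.
by rewrite scalerA -scalerDl tensDE tensZE !mulrDl !mulrA.
Qed.

Lemma tmulPr c x y y' : tmul x (c *: y + y') = c *: tmul x y + tmul x y'.
Proof.
rewrite /tmul scaler_sumr -big_split; apply: eq_bigr => u _ /=.
rewrite scaler_sumr -big_split; apply: eq_bigr => v _ /=.
rewrite scalerA -scalerDl tensDE tensZE mulrDr mulrDl.
by rewrite [x u * (c * _)]mulrCA !mulrA.
Qed.

Lemma tmul0l y : tmul 0 y = 0.
Proof.
have := tmulPl (-1) 0 0 y.
by rewrite scaler0 addr0 scaleN1r addNr.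
Qed.

Lemma tmul0r x : tmul x 0 = 0.
Proof.
have := tmulPr (-1) x 0 0.
by rewrite scaler0 addr0 scaleN1r addNr.
Qed.

Lemma tmulZl c x y : tmul (c *: x) y = c *: tmul x y.
Proof. by rewrite -[c *: x]addr0 tmulPl tmul0l addr0. Qed.

Lemma tmulZr c x y : tmul x (c *: y) = c *: tmul x y.
Proof. by rewrite -[c *: y]addr0 tmulPr tmul0r addr0. Qed.

Lemma tmulDl x x' y : tmul (x + x') y = tmul x y + tmul x' y.
Proof. by rewrite -[x]scale1r tmulPl !scale1r. Qed.

Lemma tmulDr x y y' : tmul x (y + y') = tmul x y + tmul x y'.
Proof. by rewrite -[y]scale1r tmulPr !scale1r. Qed.

Lemma tmulNl x y : tmul (- x) y = - tmul x y.
Proof. by rewrite -scaleN1r tmulZl scaleN1r. Qed.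

Lemma tmulNr x y : tmul x (- y) = - tmul x y.
Proof. by rewrite -scaleN1r tmulZr scaleN1r. Qed.

Lemma tmul_suml I (r : seq I) (P : pred I) (F : I -> tens A n) y :
  tmul (\sum_(i <- r | P i) F i) y = \sum_(i <- r | P i) tmul (F i) y.
Proof. by elim/big_rec2: _ => [|i ? ? _ <-]; rewrite ?tmul0l ?tmulDl. Qed.

Lemma tmul_sumr I (r : seq I) (P : pred I) (F : I -> tens A n) x :
  tmul x (\sum_(i <- r | P i) F i) = \sum_(i <- r | P i) tmul x (F i).
Proof. by elim/big_rec2: _ => [|i ? ? _ <-]; rewrite ?tmul0r ?tmulDr. Qed.

(** The Koszul exponent for multiplying two pure tensors whose factors have degrees [al] and [be];
    [koszul u v] is its value on basis words. *)
Definition kz (al be : 'I_n -> nat) : nat :=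
  (\sum_(i < n) \sum_(j < n | j < i) al i * be j)%N.

Lemma tensor_neq0 (al a : _) w : (forall i : 'I_n, homog (al i) (a i : A)) ->
  tensor a w != 0 -> forall i, gdeg (w i) = al i.
Proof.
by move=> ha; rewrite tensorE => nz i; apply: (ha i); apply: (prod_neq0 i nz).
Qed.

(** All pairs of words with a nonzero coefficient carry the same Koszul sign, by homogeneity. Once
    it is taken out, the sum over pairs of words factors into one double sum per position. *)
Lemma tensorM al be (a b : 'I_n -> A) :
  (forall i, homog (al i) (a i)) -> (forall i, homog (be i) (b i)) ->
  tmul (tensor a) (tensor b) =
  (-1) ^+ kz al be *: tensor (fun i => a i * b i).
Proof.
move=> ha hb.
have -> : tmul (tensor a) (tensor b) = (-1) ^+ kz al be *:
    \sum_u \sum_v (tensor a u * tensor b v) *: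
      tensor (fun i => gbasis (u i) * gbasis (v i) : A).
  rewrite scaler_sumr; apply: eq_bigr => u _.
  rewrite scaler_sumr; apply: eq_bigr => v _; rewrite scalerA.
  have [->|nz] := eqVneq (tensor a u * tensor b v) 0; first by rewrite mul0r mulr0.
  have nza : tensor a u != 0 by apply: contra_neq nz => ->; rewrite mul0r.
  have nzb : tensor b v != 0 by apply: contra_neq nz => ->; rewrite mulr0.
  congr (_ *: _); rewrite [RHS]mulrC; congr (_ * (-1) ^+ _).
  apply: eq_bigr => i _; apply: eq_bigr => j _.
  by rewrite (tensor_neq0 ha nza) (tensor_neq0 hb nzb).
congr (_ *: _); apply: tensP => w; rewrite tens_sumE tensorE.
transitivity (\prod_i \sum_s \sum_t gcoord s (a i) * gcoord t (b i) *
    gcoord (w i) (gbasis s * gbasis t : A)).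
  rewrite bigA_distr_bigA /=; apply: eq_bigr => u _.
  rewrite bigA_distr_bigA /= tens_sumE; apply: eq_bigr => v _.
  by rewrite tensZE !tensorE -!big_split.
apply: eq_bigr => i _; rewrite {2}[a i]gbasis_coord {2}[b i]gbasis_coord.
rewrite mulr_suml linear_sum; apply: eq_bigr => s _.
rewrite mulr_sumr linear_sum; apply: eq_bigr => t _.
by rewrite -scalerAl -scalerAr !linearZ /= -mulrA.
Qed.

Lemma tensorZ (c : 'I_n -> k) (a : 'I_n -> A) :
  tensor (fun i => c i *: a i) = (\prod_i c i) *: tensor a.
Proof.
apply: tensP => w; rewrite tensZE !tensorE -big_split.
by apply: eq_bigr => i _; rewrite linearZ.
Qed.

Definition hdeg (e : nat) x : Prop := forall w, x w != 0 -> wdeg w = e.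
Definition even_tens x : Prop := forall w, x w != 0 -> ~~ odd (wdeg w).

Lemma tensor_hdeg al (a : 'I_n -> A) : (forall i, homog (al i) (a i)) ->
  hdeg (\sum_i al i)%N (tensor a).
Proof.
by move=> ha w nz; apply: eq_bigr => i _; rewrite (tensor_neq0 ha nz).
Qed.

Lemma twist_linear d c x y :
  twist d (c *: x + y) = c *: twist d x + twist d y.
Proof.
apply: tensP => w; rewrite tensDE tensZE !ffunE.
by rewrite [c *: x w]/(c * x w) mulrDr mulrCA.
Qed.

Lemma twist0 d : twist d (0 : tens A n) = 0.
Proof. by apply: tensP => w; rewrite ffunE tens0E mulr0. Qed.

Lemma twistB d x y : twist d (x - y) = twist d x - twist d y.
Proof. by apply: tensP => w; rewrite !ffunE mulrDr mulrN. Qed.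

Lemma twistZ d c x : twist d (c *: x) = c *: twist d x.
Proof. by rewrite -[c *: x]addr0 twist_linear twist0 addr0. Qed.

Lemma twist_hdeg d e x : hdeg e x -> twist d x = (-1) ^+ absz (d * e%:Z) *: x.
Proof.
move=> hx; apply: tensP => w; rewrite ffunE tensZE.
by have [->|/hx->] := eqVneq (x w) 0; first by rewrite !mulr0.
Qed.

Lemma twist_even d x : even_tens x -> twist d x = x.
Proof.
move=> hx; apply: tensP => w; rewrite ffunE.
have [->|/hx ev] := eqVneq (x w) 0; first by rewrite mulr0.
by rewrite -signr_odd abszM oddM absz_nat (negbTE ev) andbF mul1r.
Qed.

Lemma homog_basis (s : 'I_(grank A)) : homog (gdeg s) (gbasis s : A).
Proof. by move=> t; rewrite gcoord_basis; case: (eqVneq t s) => [->|]; rewrite ?eqxx. Qed.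

Lemma wtens_homog w i : homog (gdeg (w i)) (gbasis (w i) : A).
Proof. exact: homog_basis. Qed.

Lemma wtens_hdeg w : hdeg (wdeg w) (wtens w).
Proof. exact: tensor_hdeg (@wtens_homog w). Qed.

Lemma tinj_linear i c (a b : A) :
  tinj i (c *: a + b) = c *: tinj i a + tinj i b :> tens A n.
Proof.
apply: tensP => w; rewrite tensDE tensZE !tensorE.
rewrite (bigD1 i) //= [in RHS](bigD1 i) //= [X in _ = _ + X](bigD1 i) //= eqxx.
rewrite linearP mulrDl; congr (_ + _); first rewrite -mulrA; congr (_ * _).
  by congr (_ * _); apply: eq_bigr => j /negbTE->.
by apply: eq_bigr => j /negbTE->.
Qed.

Lemma tinj0 i : tinj i (0 : A) = 0 :> tens A n.
Proof.
have := tinj_linear i (-1) 0 0.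
by rewrite scaler0 addr0 scaleN1r addNr.
Qed.

Lemma tinj_expand i (a : A) :
  tinj i a = \sum_s gcoord s a *: tinj i (gbasis s) :> tens A n.
Proof.
rewrite {1}[a]gbasis_coord.
elim/big_rec2: _ => [|s y x _ <-]; first exact: tinj0.
exact: tinj_linear.
Qed.
End TensorPowers.

(** * Graded commutativity and the diagonal class *)

Section FrobeniusTensors.
Variables (k : comPzRingType) (A : graded_algebra k) (m : nat).
Variables (pairing : A -> A -> k) (frob : frobenius m pairing).

Lemma homog1 : homog 0 (1 : A).
Proof. by apply/(frob_deg0 frob); exists 1; rewrite scale1r. Qed.

Section Words.
Variable n : nat.
Implicit Types (x y z : tens A n) (u v w : word A n) (c : k).
Implicit Types (al be ga : 'I_n -> nat).

Lemma tensorM_homog al be (a b : 'I_n -> A) :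
  (forall i, homog (al i) (a i)) -> (forall i, homog (be i) (b i)) ->
  forall i, homog (al i + be i)%N (a i * b i).
Proof. by move=> ha hb i; apply: (frob_grading frob). Qed.

Lemma kzDl al be ga : kz (fun i => al i + be i)%N ga = (kz al ga + kz be ga)%N.
Proof.
rewrite /kz -big_split; apply: eq_bigr => i _; rewrite -big_split.
by apply: eq_bigr => j _; rewrite /= mulnDl.
Qed.

Lemma kzDr al be ga : kz al (fun i => be i + ga i)%N = (kz al be + kz al ga)%N.
Proof.
rewrite /kz -big_split; apply: eq_bigr => i _; rewrite -big_split.
by apply: eq_bigr => j _; rewrite /= mulnDr.
Qed.

(** The index pairs split into [j < i], [i < j] and [i = j]. *)
Lemma kz_sym al be :
  ((\sum_i al i) * (\sum_i be i) = kz al be + kz be al + \sum_i al i * be i)%N.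
Proof.
have -> : kz be al = (\sum_(i < n) \sum_(j < n | i < j) al i * be j)%N.
  rewrite /kz (exchange_big_dep predT) //=; apply: eq_bigr => i _.
  by apply: eq_bigr => j _; rewrite mulnC.
rewrite /kz -!big_split big_distrl /=; apply: eq_bigr => i _.
rewrite big_distrr /= (bigID (fun j : 'I_n => (j < i)%N)) /= -addnA; congr addn.
rewrite (bigD1 i) ?ltnn //= addnC; congr addn; apply: eq_bigl => j.
by rewrite -leqNgt ltn_neqAle andbC -(inj_eq val_inj) eq_sym.
Qed.

Lemma tmulA x y z : tmul x (tmul y z) = tmul (tmul x y) z.
Proof.
elim/tens_ind: x => [|c x x' Ex Ex'|u]; first by rewrite !tmul0l.
  by rewrite !tmulPl Ex Ex'.
elim/tens_ind: y => [|c y y' Ey Ey'|v]; first by rewrite !(tmul0l, tmul0r).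
  by rewrite !(tmulPl, tmulPr) Ey Ey'.
elim/tens_ind: z => [|c z z' Ez Ez'|w]; first by rewrite !tmul0r.
  by rewrite !tmulPr Ez Ez'.
have [hu hv hw] := And3 (@wtens_homog _ _ _ u) (@wtens_homog _ _ _ v) (@wtens_homog _ _ _ w).
rewrite /wtens (tensorM hv hw) (tensorM hu hv) tmulZr tmulZl.
rewrite (tensorM hu (tensorM_homog hv hw)) (tensorM (tensorM_homog hu hv) hw).
rewrite !scalerA -!exprD kzDl kzDr; congr (_ ^+ _ *: _); last first.
  by apply: eq_tensor => i; rewrite mulrA.
by rewrite addnC -addnA.
Qed.

Lemma tmul1l x : tmul (tone A n) x = x.
Proof.
elim/tens_ind: x => [|c x x' Ex Ex'|u]; first by rewrite !tmul0r.
  by rewrite !tmulPr Ex Ex'.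
have h1 : forall i : 'I_n, homog 0 (1 : A) by move=> _; apply: homog1.
rewrite /tone /wtens (tensorM h1 (@wtens_homog _ _ _ u)) /kz big1.
  by rewrite expr0 scale1r; apply: eq_tensor => i; rewrite mul1r.
by move=> i _; rewrite big1.
Qed.

Lemma tone_hdeg : hdeg 0 (tone A n).
Proof.
have := @tensor_hdeg k A n (fun=> 0%N) (fun=> 1) (fun=> homog1).
by rewrite big1.
Qed.

Lemma twist_tone d : twist d (tone A n) = tone A n.
Proof. by rewrite (twist_hdeg _ tone_hdeg) mulr0 scale1r. Qed.

(** Commuting the factors position by position costs the diagonal part of the exponent; the two
    Koszul signs supply the off-diagonal part, and [kz_sym] adds them up. *)
Lemma tensorC al be (a b : 'I_n -> A) :
  (forall i, homog (al i) (a i)) -> (forall i, homog (be i) (b i)) ->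
  tmul (tensor a) (tensor b) =
  (-1) ^+ ((\sum_i al i) * (\sum_i be i))%N *: tmul (tensor b) (tensor a).
Proof.
move=> ha hb; rewrite (tensorM ha hb) (tensorM hb ha).
have -> : tensor (fun i => a i * b i) =
    (-1) ^+ (\sum_i al i * be i)%N *: tensor (fun i => b i * a i).
  rewrite expr_sum -tensorZ; apply: eq_tensor => i.
  exact: (frob_comm frob (ha i) (hb i)).
rewrite !scalerA -!exprD; congr (_ *: _); apply: sign_parity.
by rewrite kz_sym !oddD; do 3!case: odd.
Qed.

Lemma tmul_evenC x y : even_tens x -> tmul x y = tmul y x.
Proof.
move=> ev; rewrite [x]tens_expand tmul_suml tmul_sumr; apply: eq_bigr => u _.
have [->|/ev od] := eqVneq (x u) 0; first by rewrite !scale0r tmul0l tmul0r.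
rewrite tmulZl tmulZr; congr (_ *: _).
elim/tens_ind: y => [|c y y' Ey Ey'|v]; first by rewrite tmul0l tmul0r.
  by rewrite tmulPr tmulPl Ey Ey'.
rewrite /wtens (tensorC (@wtens_homog _ _ _ u) (@wtens_homog _ _ _ v)).
by rewrite -signr_odd oddM (negbTE od) scale1r.
Qed.

Lemma twist_tmul d x y : twist d (tmul x y) = tmul (twist d x) (twist d y).
Proof.
elim/tens_ind: x => [|c x x' Ex Ex'|u]; first by rewrite !(tmul0l, twist0).
  by rewrite !(twist_linear, tmulPl) Ex Ex'.
elim/tens_ind: y => [|c y y' Ey Ey'|v]; first by rewrite !(tmul0r, twist0).
  by rewrite !(twist_linear, tmulPr) Ey Ey'.
have [hu hv] := conj (@wtens_homog _ _ _ u) (@wtens_homog _ _ _ v).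
rewrite (twist_hdeg d (@wtens_hdeg _ _ _ u)) (twist_hdeg d (@wtens_hdeg _ _ _ v)).
rewrite tmulZl tmulZr scalerA /wtens (tensorM hu hv) twistZ.
rewrite (twist_hdeg d (tensor_hdeg (tensorM_homog hu hv))) !scalerA.
congr (_ *: _); rewrite mulrC; congr (_ * _).
rewrite -exprD; apply: sign_parity; rewrite big_split /= !abszM !absz_nat.
by rewrite oddD !oddM oddD andb_addr.
Qed.

Lemma tinj_homog i d (a : A) : homog d a ->
  forall j : 'I_n, homog (if j == i then d else 0%N) (if j == i then a else 1).
Proof. by move=> ha j; case: eqP => // _; apply: homog1. Qed.

Lemma tinj_hdeg i d (a : A) : homog d a -> hdeg d (tinj i a : tens A n).
Proof.
move=> ha; have := tensor_hdeg (tinj_homog (i:=i) ha).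
by rewrite -big_mkcond big_pred1_eq.
Qed.

Lemma tinjC i j d e (a b : A) : homog d a -> homog e b ->
  tmul (tinj i a) (tinj j b) = (-1) ^+ (d * e) *: tmul (tinj j b) (tinj i a) :> tens A n.
Proof.
move=> ha hb; rewrite /tinj (tensorC (tinj_homog (i:=i) ha) (tinj_homog (i:=j) hb)).
by rewrite -!big_mkcond !big_pred1_eq.
Qed.

Lemma tinjM_hdeg i j d e (a b : A) : homog d a -> homog e b ->
  hdeg (d + e) (tmul (tinj i a) (tinj j b) : tens A n).
Proof.
move=> ha hb w; rewrite (tensorM (tinj_homog (i:=i) ha) (tinj_homog (i:=j) hb)) tensZE.
move=> nz; have {nz} : tensor (fun l => (if l == i then a else 1) *
   (if l == j then b else 1)) w != 0 by apply: contra_neq nz => ->; rewrite mulr0.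
move/(tensor_hdeg (tensorM_homog (tinj_homog (i:=i) ha) (tinj_homog (i:=j) hb))) => ->.
by rewrite big_split -!big_mkcond /= !big_pred1_eq.
Qed.
End Words.

(** * Nondegeneracy of the pairing in coordinates *)

Notation P s t := (pairing (gbasis s) (gbasis t)).

Lemma pairing0r a : pairing a 0 = 0.
Proof. by have := frob_linear_r frob (-1) a 0 0; rewrite scaler0 addr0 mulN1r addNr. Qed.

Lemma pairing0l a : pairing 0 a = 0.
Proof. by have := frob_linear_l frob (-1) 0 0 a; rewrite scaler0 addr0 mulN1r addNr. Qed.

Lemma pairing_suml (y : 'I_(grank A) -> k) b :
  pairing (\sum_s y s *: gbasis s) b = \sum_s y s * pairing (gbasis s) b.
Proof.
elim/big_rec2: _ => [|s c x _ <-]; first exact: pairing0l.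
exact: (frob_linear_l frob).
Qed.

Lemma pairing_sumr (y : 'I_(grank A) -> k) a :
  pairing a (\sum_s y s *: gbasis s) = \sum_s y s * pairing a (gbasis s).
Proof.
elim/big_rec2: _ => [|s c x _ <-]; first exact: pairing0r.
exact: (frob_linear_r frob).
Qed.

Lemma pairing_deg s t : P s t != 0 -> (gdeg s + gdeg t)%N = m.
Proof.
move=> nz; apply/eqP; apply: contraNT nz => /eqP ne; apply/eqP.
by apply: (frob_degree frob) ne; apply: homog_basis.
Qed.

Lemma gcoord_sum (y : 'I_(grank A) -> k) s :
  gcoord s (\sum_t y t *: gbasis t : A) = y s.
Proof.
rewrite linear_sum (bigD1 s) //= big1 => [|t ne]; rewrite linearZ /= gcoord_basis.
  by rewrite addr0 eqxx [_ *: _]mulr1.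
by rewrite eq_sym (negbTE ne) scaler0.
Qed.

(** This is the uniqueness in [frob_perfect] at the zero functional, for the element with
    coordinates [y]. *)
Lemma pairing_nondegl (y : 'I_(grank A) -> k) :
  (forall t, \sum_s y s * P s t = 0) -> forall s, y s = 0.
Proof.
move=> y0 s; rewrite -[y s]gcoord_sum; set a := \sum_t _.
suff -> : a = 0 by rewrite linear0.
have [z [_ zu]] := frob_perfect frob \0.
rewrite -(zu 0) => [|b]; last exact: pairing0l.
apply/esym/zu => b; rewrite [b]gbasis_coord pairing_sumr big1 // => t _.
by rewrite pairing_suml y0 mulr0.
Qed.

(** The sign in [frob_sym] depends on [t] alone, because [gdeg s] is [m - gdeg t] wherever the
    pairing is nonzero. *)
Lemma pairing_nondegr (y : 'I_(grank A) -> k) :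
  (forall t, \sum_s y s * P t s = 0) -> forall s, y s = 0.
Proof.
move=> y0; apply: pairing_nondegl => t.
transitivity ((-1) ^+ ((m - gdeg t) * gdeg t) * \sum_s y s * P t s); last first.
  by rewrite y0 mulr0.
rewrite mulr_sumr; apply: eq_bigr => s _.
rewrite (frob_sym frob (@homog_basis _ _ s) (@homog_basis _ _ t)) mulrCA.
have [->|/pairing_deg E] := eqVneq (P t s) 0; first by rewrite !mulr0.
by congr ((-1) ^+ (_ * _) * _); rewrite -E addKn.
Qed.

Definition word2 (s t : 'I_(grank A)) : word A 2 :=
  [ffun i : 'I_2 => if i == ord0 then s else t].

Lemma word2_0 s t : word2 s t ord0 = s. Proof. by rewrite ffunE. Qed.
Lemma word2_1 s t : word2 s t ord_max = t. Proof. by rewrite ffunE. Qed.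

Lemma word2E (w : word A 2) : w = word2 (w ord0) (w ord_max).
Proof.
apply/ffunP => i; rewrite ffunE; have [->//|ne] := eqVneq i ord0.
congr (w _); apply: val_inj; case: i ne => i lti; rewrite -val_eqE /= => ne.
by lia.
Qed.

Lemma sum_word2 (V : nmodType) (F : word A 2 -> V) :
  \sum_w F w = \sum_s \sum_t F (word2 s t).
Proof.
have bij : bijective (fun p : 'I_(grank A) * 'I_(grank A) => word2 p.1 p.2).
  exists (fun w : word A 2 => (w ord0, w ord_max)) => [[s t]|w] /=.
    by rewrite word2_0 word2_1.
  by rewrite -word2E.
by rewrite (reindex _ (onW_bij _ bij)) pair_bigA.
Qed.

Lemma tensor2_basis s t : tensor2 (gbasis s) (gbasis t) = wtens (word2 s t) :> tens A 2.
Proof. by apply: eq_tensor => i; rewrite ffunE; case: eqP. Qed.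

(* The matrix of [X |-> < b_p (x) b_q , X >_2]. *)
Definition pair2 (X : 'I_(grank A) -> 'I_(grank A) -> k) p q : k :=
  \sum_s \sum_t X s t * ((-1) ^+ (gdeg q * gdeg s) * (P p s * P q t)).

Lemma pairing2_basis p q (x : tens A 2) :
  pairing2 pairing (tensor2 (gbasis p) (gbasis q)) x =
  pair2 (fun s t => x (word2 s t)) p q.
Proof.
rewrite /pairing2 (bigD1 (word2 p q)) //= [X in _ + X]big1 ?addr0 => [|u ne].
  rewrite sum_word2; apply: eq_bigr => s _; apply: eq_bigr => t _.
  by rewrite tensor2_basis wtensE eqxx mul1r !word2_0 !word2_1 -mulrA.
by rewrite big1 // => v _; rewrite tensor2_basis wtensE (negbTE ne) !mul0r.
Qed.

(** Nondegeneracy is applied once in each tensor factor. The sign depends on [s], so it is kept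
    inside the coordinate function of the first application and cancelled afterwards. *)
Lemma pair2_inj X Y : (forall p q, pair2 X p q = pair2 Y p q) ->
  forall s t, X s t = Y s t.
Proof.
move=> E s t; apply/eqP; rewrite -subr_eq0; apply/eqP; move: t.
apply: pairing_nondegr => q.
have := @pairing_nondegr (fun s => (-1) ^+ (gdeg q * gdeg s) *
  \sum_t (X s t - Y s t) * P q t) _ s.
move=> H; apply: (can_inj (signrMK (gdeg q * gdeg s))); rewrite mulr0; apply: H.
move=> p; transitivity (pair2 X p q - pair2 Y p q); last by rewrite E subrr.
rewrite /pair2 -sumrB; apply: eq_bigr => r _; rewrite -sumrB -mulrA mulr_suml mulr_sumr.
by apply: eq_bigr => t _; rewrite -mulrBl -!mulrA mulrCA [P q t * _]mulrC.
Qed.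

(** * Degree and symmetry of the diagonal class *)

Section Diagonal.
Variables (m_even : ~~ odd m) (Delta : tens A 2).
Hypothesis (diag : diagonal_class pairing Delta).

Lemma diag_pair2 p q :
  pair2 (fun s t => Delta (word2 s t)) p q = pairing (gbasis p * gbasis q) 1.
Proof. by rewrite -pairing2_basis diag. Qed.

(** [X] is the part of [Delta] of total degree [m], and it has the same pairings as [Delta]: if
    [gdeg p + gdeg q] is [m], only this part contributes, and otherwise both pairings vanish. *)
Lemma Delta_deg s t : Delta (word2 s t) != 0 -> (gdeg s + gdeg t)%N = m.
Proof.
move=> nz; apply/eqP; apply: contraNT nz => /negbTE ne.
pose X s t := if (gdeg s + gdeg t == m)%N then Delta (word2 s t) else 0.
suff -> : Delta (word2 s t) = X s t by rewrite /X ne.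
apply: (@pair2_inj (fun s t => Delta (word2 s t)) X) => p q.
have [pq|/eqP pq] := eqVneq (gdeg p + gdeg q)%N m.
  apply: eq_bigr => a _; apply: eq_bigr => b _; rewrite /X; case: eqP => // ab.
  have [->|/pairing_deg pa] := eqVneq (P p a) 0; first by rewrite !(mul0r, mulr0).
  have [->|/pairing_deg qb] := eqVneq (P q b) 0; first by rewrite !(mul0r, mulr0).
  by case: ab; lia.
rewrite diag_pair2 (frob_degree frob (frob_grading frob (@homog_basis _ _ p)
  (@homog_basis _ _ q)) homog1) ?addn0 //.
rewrite /pair2 big1 // => a _; rewrite big1 // => b _; rewrite /X.
case: eqP => ab; last by rewrite mul0r.
have [->|/pairing_deg pa] := eqVneq (P p a) 0; first by rewrite !(mul0r, mulr0).
have [->|/pairing_deg qb] := eqVneq (P q b) 0; first by rewrite !(mul0r, mulr0).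
by case: pq; lia.
Qed.

(** Commuting [gbasis p] and [gbasis q] in the defining property of [Delta] gives the symmetry of
    the pairings. In the comparison of signs [t'] and [s'] have degrees [m - gdeg p] and
    [m - gdeg q], which for even [m] have the parities of [gdeg p] and [gdeg q]. *)
Lemma Delta_sym s t :
  Delta (word2 s t) = (-1) ^+ (gdeg s * gdeg t) * Delta (word2 t s).
Proof.
apply: (@pair2_inj (fun s t => Delta (word2 s t))
  (fun s t => (-1) ^+ (gdeg s * gdeg t) * Delta (word2 t s))) => p q.
rewrite diag_pair2 (frob_sym frob (frob_grading frob (@homog_basis _ _ p)
  (@homog_basis _ _ q)) homog1) muln0 mul1r.
rewrite (frob_comm frob (@homog_basis _ _ p) (@homog_basis _ _ q)).
rewrite -[_ *: _]addr0 (frob_linear_r frob) pairing0r addr0.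
rewrite (frob_sym frob homog1 (frob_grading frob (@homog_basis _ _ q)
  (@homog_basis _ _ p))) mul0n mul1r -diag_pair2.
rewrite /pair2 exchange_big mulr_sumr; apply: eq_bigr => t' _.
rewrite mulr_sumr; apply: eq_bigr => s' _.
have [->|/pairing_deg pa] := eqVneq (P p t') 0; first by rewrite !(mul0r, mulr0).
have [->|/pairing_deg qb] := eqVneq (P q s') 0; first by rewrite !(mul0r, mulr0).
rewrite [P q s' * _]mulrC !mulrA; congr (_ * _ * _).
rewrite [LHS]mulrAC [RHS]mulrAC; congr (_ * _); rewrite -!exprD.
apply: sign_parity; move: m_even; rewrite -{1}pa; move: qb; rewrite -pa => qb.
have := congr1 odd qb.
by rewrite !(oddD, oddM); do 4!case: odd.
Qed.

Lemma tpull_hdeg n (i j : 'I_n) : hdeg m (tpull i j Delta).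
Proof.
move=> w; rewrite /tpull tens_sumE => nz; apply/eqP; apply: contraNT nz => ne.
rewrite big1 // => v _; rewrite tensZE.
have [->|nzv] := eqVneq (Delta v) 0; first by rewrite mul0r.
have E : (gdeg (v ord0) + gdeg (v ord_max))%N = m by apply: Delta_deg; rewrite -word2E.
set y := tmul _ _; have [->|h] := eqVneq (y w) 0; first by rewrite mulr0.
case/negP: ne; apply/eqP; rewrite -E.
exact: (tinjM_hdeg (@homog_basis _ _ _) (@homog_basis _ _ _) h).
Qed.

Lemma tpull_even n (i j : 'I_n) : even_tens (tpull i j Delta).
Proof. by move=> w /tpull_hdeg ->. Qed.

Lemma tpull_sym n (i j : 'I_n) : tpull i j Delta = tpull j i Delta.
Proof.
rewrite /tpull !sum_word2 exchange_big; apply: eq_bigr => s _; apply: eq_bigr => t _.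
rewrite !word2_0 !word2_1 Delta_sym (tinjC _ _ (@homog_basis _ _ t) (@homog_basis _ _ s)).
by rewrite scalerA mulrC signrMK.
Qed.
End Diagonal.
End FrobeniusTensors.

Lemma big_disjU (V : nmodType) (I : finType) (X Y : {set I}) (F : I -> V) :
  [disjoint X & Y] ->
  \sum_(i in X :|: Y) F i = \sum_(i in X) F i + \sum_(i in Y) F i.
Proof.
move=> dXY; rewrite -(bigU _ _ _ dXY); apply: eq_bigl => i.
by rewrite !inE.
Qed.

Lemma setD1_out (I : finType) (X : {set I}) x : x \notin X -> X :\ x = X.
Proof. by move=> nXx; apply/setDidPl; rewrite disjoint_sym disjoints1. Qed.

(** * Signs in the exterior algebra *)

Section EdgeSigns.
Variables (k : comPzRingType) (n : nat) (G : graph n).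
Implicit Types (S T U : {set edge G}) (e f : edge G).

Lemma eposE e S : epos e S = (\sum_(f in S) (f < e))%N.
Proof.
rewrite /epos -sum1_card big_mkcond [RHS]big_mkcond /=.
by apply: eq_bigr => f _; rewrite inE; case: (f \in S) => //=; case: ltnP.
Qed.

Lemma eposU e S T : [disjoint S & T] -> epos e (S :|: T) = (epos e S + epos e T)%N.
Proof. by move=> dST; rewrite !eposE big_disjU. Qed.

Lemma eposD1 e f S : f \in S -> epos e S = ((f < e) + epos e (S :\ f))%N.
Proof. by move=> Sf; rewrite !eposE (big_setD1 f). Qed.

Lemma eposD1_same e S : epos e (S :\ e) = epos e S.
Proof.
have [Se|/setD1_out->//] := boolP (e \in S).
by rewrite (eposD1 e Se) ltnn.
Qed.

Lemma epos_setU1_same e S : epos e (e |: S) = epos e S.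
Proof.
have [Se|nSe] := boolP (e \in S); first by congr epos; apply/setUidPr; rewrite sub1set.
by rewrite -eposD1_same setU1K.
Qed.

Lemma epos_compl e S : e \notin S -> (\sum_(s in S) (e < s) + epos e S)%N = #|S|.
Proof.
move=> nSe; rewrite eposE -big_split -sum1_card; apply: eq_bigr => f Sf /=.
have ne : f != e :> nat by rewrite val_eqE; apply: contraNneq nSe => <-.
by case: ltngtP ne.
Qed.

Lemma einvD1l e S T : e \in S -> einv S T = (epos e T + einv (S :\ e) T)%N.
Proof. by move=> Se; rewrite /einv (big_setD1 e). Qed.

Lemma einvD1r e S T : e \in T ->
  einv S T = (\sum_(s in S) (e < s) + einv S (T :\ e))%N.
Proof.
move=> Te; rewrite /einv -big_split; apply: eq_bigr => s _ /=.
by rewrite (eposD1 s Te).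
Qed.

Lemma einv0l T : einv set0 T = 0%N. Proof. by rewrite /einv big_set0. Qed.
Lemma einv0r S : einv S (finset.set0) = 0%N.
Proof. by rewrite /einv big1 // => e _; rewrite eposE big_set0. Qed.

(* [G_S G_T = ext_sign S T G_(S :|: T)] in the exterior algebra. *)
Definition ext_sign S T : k := if [disjoint S & T] then (-1) ^+ einv S T else 0.

Lemma ext_sign_sq S T : [disjoint S & T] -> ext_sign S T * ext_sign S T = 1.
Proof. by move=> d; rewrite /ext_sign d -expr2 sqrr_sign. Qed.

Lemma disjointI S T e : e \in S -> e \in T -> [disjoint S & T] = false.
Proof. by move=> Se Te; apply/pred0Pn; exists e; rewrite /= Se. Qed.

Variables (V : lmodType k) (phi : {set edge G} -> V).

(** [phi S] stands for [G_S] with a fixed tensor as coefficient. *)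
Definition ext_d S : V := \sum_(e in S) (-1) ^+ epos e S *: phi (S :\ e).

(* [D] being the derivation of the exterior algebra with [D G_e = 1], this is
   [D(G_S) G_T = D(G_S G_T) - (-1) ^+ #|S| G_S D(G_T)]. *)
Lemma ext_leibniz S T :
  \sum_(e in S) (-1) ^+ epos e S *: (ext_sign (S :\ e) T *: phi (S :\ e :|: T)) =
  ext_sign S T *: ext_d (S :|: T) -
  (-1) ^+ #|S| *:
    \sum_(e in T) (-1) ^+ epos e T *: (ext_sign S (T :\ e) *: phi (S :|: T :\ e)).
Proof.
have [dST|] := boolP [disjoint S & T].
  rewrite {2}/ext_sign dST /ext_d big_disjU //= scalerDr -addrA.
  rewrite [X in _ = _ + X](_ : _ = 0) ?addr0.
    rewrite scaler_sumr; apply: eq_bigr => e Se.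
    have nTe : e \notin T by rewrite (disjointFr dST Se).
    have d' : [disjoint S :\ e & T] by apply: disjointWl dST; apply: subD1set.
    rewrite /ext_sign d' !scalerA -!exprD; congr (_ *: phi _).
      apply: sign_parity; rewrite (einvD1l T Se) eposU // !oddD.
      by do 3!case: odd.
    by rewrite setDUl; congr (_ :|: _); rewrite setD1_out.
  apply/eqP; rewrite subr_eq0 !scaler_sumr; apply/eqP; apply: eq_bigr => e Te.
  have nSe : e \notin S by rewrite (disjointFl dST Te).
  have d' : [disjoint S & T :\ e] by apply: disjointWr dST; apply: subD1set.
  rewrite /ext_sign d' !scalerA -!exprD; congr (_ *: phi _).
    apply: sign_parity; rewrite (einvD1r S Te) eposU // -(epos_compl nSe) !oddD.
    by do 4!case: odd.
  by rewrite setDUl; congr (_ :|: _); rewrite setD1_out.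
(* If [S] and [T] share [e], every term that keeps [e] on both sides is zero. What is left is the
   removal of [e] from [S] and its removal from [T], and these two terms cancel. *)
move=> nd; rewrite {2}/ext_sign (negbTE nd).
case/pred0Pn: nd => e /= /andP[Se Te]; rewrite scale0r add0r.
have z1 U W : e \in U -> ext_sign U T *: phi W = 0.
  by move=> Ue; rewrite /ext_sign (disjointI Ue Te) scale0r.
have z2 U W : e \in U -> ext_sign S U *: phi W = 0.
  by move=> Ue; rewrite /ext_sign (disjointI Se Ue) scale0r.
rewrite (big_setD1 e Se) (big_setD1 e Te) /=.
rewrite [X in _ + X = _]big1 => [|f]; last first.
  by rewrite !inE => /andP[fe Sf]; rewrite z1 ?scaler0 // !inE eq_sym fe.
rewrite [X in _ = - (_ *: (_ + X))]big1 => [|f]; last first.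
  by rewrite !inE => /andP[fe Tf]; rewrite z2 ?scaler0 // !inE eq_sym fe.
rewrite !addr0.
have -> : S :\ e :|: T = S :|: T :\ e.
  apply/setP => f; rewrite !inE; case: (eqVneq f e) => [->|//] /=.
  by rewrite Se Te.
have nSe : e \notin S :\ e by rewrite !inE eqxx.
have -> : ext_sign S (T :\ e) = if [disjoint S :\ e & T] then (-1) ^+ einv S (T :\ e) else 0.
  rewrite /ext_sign; congr (if _ then _ else _).
  rewrite -!setI_eq0; congr (_ == _); apply/setP => f.
  by rewrite !inE; case: (f == e); rewrite ?andbF.
rewrite /ext_sign; case: ifP => d'; last by rewrite !(scale0r, scaler0) oppr0.
have signS a : - (-1) ^+ a = (-1) ^+ a.+1 :> k by rewrite exprS mulN1r.
rewrite !scalerA -!exprD -scaleNr signS.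
congr (_ *: _); apply: sign_parity.
rewrite (einvD1r _ Te) (einvD1l (T :\ e) Se) (cardsD1 e S) Se -(epos_compl nSe).
by rewrite !eposD1_same !oddD /= !oddD /=; do 4!case: odd.
Qed.

Lemma ext_d_setU S T : [disjoint S & T] ->
  ext_d (S :|: T) = ext_sign S T *:
    (\sum_(e in S) (-1) ^+ epos e S *: (ext_sign (S :\ e) T *: phi (S :\ e :|: T))
     + (-1) ^+ #|S| *: \sum_(e in T) (-1) ^+ epos e T *:
         (ext_sign S (T :\ e) *: phi (S :|: T :\ e))).
Proof. by move=> dST; rewrite ext_leibniz subrK scalerA ext_sign_sq // scale1r. Qed.

Lemma ext_leibniz_r S T :
  \sum_(e in T) (-1) ^+ epos e T *: (ext_sign S (T :\ e) *: phi (S :|: T :\ e)) =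
  (-1) ^+ #|S| *: (ext_sign S T *: ext_d (S :|: T) -
  \sum_(e in S) (-1) ^+ epos e S *: (ext_sign (S :\ e) T *: phi (S :\ e :|: T))).
Proof.
by rewrite ext_leibniz opprB [X in _ *: X]addrC subrK scalerA -expr2 sqrr_sign scale1r.
Qed.

(** This is [G_T = D(G_e G_T) + G_e D(G_T)]. For [e] in [T] the first term vanishes, and [G_T] is a
    multiple of [D(G_T)]. *)
Lemma ext_leibniz1 e T : phi T = ext_sign [set e] T *: ext_d (e |: T) +
  \sum_(f in T) (-1) ^+ epos f T *: (ext_sign [set e] (T :\ f) *: phi (e |: T :\ f)).
Proof.
have := ext_leibniz [set e] T; rewrite big_set1 cards1 setDv expr1 scaleN1r opprK => <-.
rewrite eposE big_set1 ltnn expr0 scale1r set0U /ext_sign -setI_eq0 set0I eqxx.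
by rewrite einv0l expr0 scale1r.
Qed.
End EdgeSigns.

(** * The relations of R *)

Section Ideals.
Variables (k : pzRingType) (V : lmodType k) (mul : V -> V -> V) (gens : V -> Prop).
Notation I := (ideal mul gens).

Lemma idealN x : I x -> I (- x).
Proof. by rewrite -scaleN1r; apply: idealZ. Qed.

Lemma ideal_sum J (r : seq J) (Q : pred J) (F : J -> V) :
  (forall j, Q j -> I (F j)) -> I (\sum_(j <- r | Q j) F j).
Proof. by move=> IF; elim/big_rec: _ => [|j x Qj]; [exact: ideal0 | apply/idealD/IF]. Qed.

Lemma ideal_signZ a x : I ((-1) ^+ a *: x) -> I x.
Proof. by move/(idealZ ((-1) ^+ a)); rewrite scalerA -expr2 sqrr_sign scale1r. Qed.
End Ideals.

Section PreAlgebra.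
Variables (k : comPzRingType) (A : graded_algebra k) (m : nat).
Variables (pairing : A -> A -> k) (frob : frobenius m pairing).
Variables (n : nat) (G : graph n).
Implicit Types (S T U : {set edge G}) (e f : edge G) (x y z : tens A n).
Implicit Types (p q : pre A G) (c : k).
Notation pmul := (@pmul k A m n G).

Lemma preP p q : (forall S, p S = q S) -> p = q.
Proof. by move=> E; apply/ffunP. Qed.
Lemma pre0E S : (0 : pre A G) S = 0. Proof. exact: ffunE. Qed.
Lemma preDE p q S : (p + q) S = p S + q S. Proof. exact: ffunE. Qed.
Lemma preZE c p S : (c *: p) S = c *: p S. Proof. exact: ffunE. Qed.
Lemma preNE p S : (- p) S = - p S. Proof. exact: ffunE. Qed.
Lemma pre_sumE I (r : seq I) (P : pred I) (F : I -> pre A G) S :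
  (\sum_(i <- r | P i) F i) S = \sum_(i <- r | P i) F i S.
Proof. by elim/big_rec2: _ => [|i ? ? _ <-]; rewrite ?pre0E ?preDE. Qed.

Lemma gtermE S x T : gterm S x T = if T == S then x else 0.
Proof. exact: ffunE. Qed.

Lemma gterm_linear S c x y : gterm S (c *: x + y) = c *: gterm S x + gterm S y.
Proof.
apply: preP => T; rewrite preDE preZE !gtermE.
by case: ifP => // _; rewrite scaler0 addr0.
Qed.

Lemma gterm0 S : gterm S (0 : tens A n) = 0.
Proof. by apply: preP => T; rewrite gtermE pre0E if_same. Qed.

Lemma gtermZ S c x : gterm S (c *: x) = c *: gterm S x.
Proof. by rewrite -[c *: x]addr0 gterm_linear gterm0 addr0. Qed.

Lemma gtermD S x y : gterm S (x + y) = gterm S x + gterm S y.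
Proof. by rewrite -[x]scale1r gterm_linear !scale1r. Qed.

Lemma gtermB S x y : gterm S (x - y) = gterm S x - gterm S y.
Proof. by rewrite gtermD -scaleN1r gtermZ scaleN1r. Qed.

Lemma gterm_sum I (r : seq I) (P : pred I) (F : I -> tens A n) S :
  gterm S (\sum_(i <- r | P i) F i) = \sum_(i <- r | P i) gterm S (F i).
Proof. by elim/big_rec2: _ => [|i ? ? _ <-]; rewrite ?gterm0 ?gtermD. Qed.

Lemma pre_expand p : p = \sum_S gterm S (p S).
Proof.
apply: preP => T; rewrite pre_sumE (bigD1 T) //= gtermE eqxx.
by rewrite big1 ?addr0 // => S ne; rewrite gtermE eq_sym (negbTE ne).
Qed.

Lemma pre_ind (P : pre A G -> Prop) : P 0 -> (forall p q, P p -> P q -> P (p + q)) ->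
  (forall S x, P (gterm S x)) -> forall p, P p.
Proof.
move=> P0 PD Pg p; rewrite [p]pre_expand.
by elim/big_rec: _ => // S q _; apply: PD.
Qed.

Lemma pmulPl c p p' q : pmul (c *: p + p') q = c *: pmul p q + pmul p' q.
Proof.
rewrite /Defs.pmul scaler_sumr -big_split; apply: eq_bigr => S _ /=.
rewrite scaler_sumr -big_split; apply: eq_bigr => T _ /=.
by rewrite preDE preZE twist_linear tmulPl gterm_linear scalerDr !scalerA mulrC.
Qed.

Lemma pmulPr c p q q' : pmul p (c *: q + q') = c *: pmul p q + pmul p q'.
Proof.
rewrite /Defs.pmul scaler_sumr -big_split; apply: eq_bigr => S _ /=.
rewrite scaler_sumr -big_split; apply: eq_bigr => T _ /=.
by rewrite preDE preZE tmulPr gterm_linear scalerDr !scalerA mulrC.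
Qed.

Lemma pmul0l q : pmul 0 q = 0.
Proof. by have := pmulPl (-1) 0 0 q; rewrite scaler0 addr0 scaleN1r addNr. Qed.

Lemma pmul0r p : pmul p 0 = 0.
Proof. by have := pmulPr (-1) p 0 0; rewrite scaler0 addr0 scaleN1r addNr. Qed.

Lemma pmulZl c p q : pmul (c *: p) q = c *: pmul p q.
Proof. by rewrite -[c *: p]addr0 pmulPl pmul0l addr0. Qed.

Lemma pmulZr c p q : pmul p (c *: q) = c *: pmul p q.
Proof. by rewrite -[c *: q]addr0 pmulPr pmul0r addr0. Qed.

Lemma pmulDl p p' q : pmul (p + p') q = pmul p q + pmul p' q.
Proof. by rewrite -[p]scale1r pmulPl !scale1r. Qed.

Lemma pmulDr p q q' : pmul p (q + q') = pmul p q + pmul p q'.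
Proof. by rewrite -[q]scale1r pmulPr !scale1r. Qed.

Lemma pmulBl p p' q : pmul (p - p') q = pmul p q - pmul p' q.
Proof. by rewrite addrC -scaleN1r pmulPl scaleN1r addrC. Qed.

Lemma pmulBr p q q' : pmul p (q - q') = pmul p q - pmul p q'.
Proof. by rewrite addrC -scaleN1r pmulPr scaleN1r addrC. Qed.

Lemma pmul_suml I (r : seq I) (P : pred I) (F : I -> pre A G) q :
  pmul (\sum_(i <- r | P i) F i) q = \sum_(i <- r | P i) pmul (F i) q.
Proof. by elim/big_rec2: _ => [|i ? ? _ <-]; rewrite ?pmul0l ?pmulDl. Qed.

Lemma pmul_sumr I (r : seq I) (P : pred I) (F : I -> pre A G) q :
  pmul q (\sum_(i <- r | P i) F i) = \sum_(i <- r | P i) pmul q (F i).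
Proof. by elim/big_rec2: _ => [|i ? ? _ <-]; rewrite ?pmul0r ?pmulDr. Qed.

Lemma pmul_gterm S T x y : pmul (gterm S x) (gterm T y) =
  ext_sign k S T *: gterm (S :|: T) (tmul (twist ((m%:Z - 1) * #|T|%:Z) x) y).
Proof.
rewrite /Defs.pmul (bigD1 S) //= [X in _ + X]big1 ?addr0 => [|S' ne]; last first.
  rewrite big1 // => T' _.
  by rewrite [gterm S x S']gtermE (negbTE ne) twist0 tmul0l gterm0 scaler0.
rewrite /ext_sign; case: ifPn => dST; last first.
  rewrite big1 ?scale0r // => T' dST'; rewrite [gterm T y T']gtermE.
  case: eqP => [E|_]; last by rewrite tmul0r gterm0 scaler0.
  by rewrite -E dST' in dST.
rewrite (bigD1 T) //= [X in _ + X]big1 ?addr0 => [|T' /andP[_ ne]].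
  by rewrite !gtermE !eqxx.
by rewrite [gterm T y T']gtermE (negbTE ne) tmul0r gterm0 scaler0.
Qed.

Lemma pmul_pin_gterm T x y : pmul (pin G x) (gterm T y) =
  gterm T (tmul (twist ((m%:Z - 1) * #|T|%:Z) x) y).
Proof.
rewrite /pin pmul_gterm set0U /ext_sign einv0l.
by rewrite -setI_eq0 set0I eqxx scale1r.
Qed.

Lemma twist_0l x : twist 0 x = x.
Proof. by apply: tensP => w; rewrite ffunE mul0r mul1r. Qed.

Lemma pmul_gterm_pin S x y : pmul (gterm S x) (pin G y) = gterm S (tmul x y).
Proof.
rewrite /pin pmul_gterm setU0 /ext_sign einv0r cards0 mulr0 twist_0l.
by rewrite -setI_eq0 setI0 eqxx scale1r.
Qed.

Lemma pmul_ext_gterm S T y : pmul (gterm S (tone A n)) (gterm T y) =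
  ext_sign k S T *: gterm (S :|: T) y.
Proof. by rewrite pmul_gterm (twist_tone frob) (tmul1l frob). Qed.

Lemma gterm_split S T x : S \subset T ->
  gterm T x = ext_sign k S (T :\: S) *:
    pmul (gterm S (tone A n)) (gterm (T :\: S) x).
Proof.
move=> sST; rewrite pmul_ext_gterm scalerA ext_sign_sq.
  by rewrite scale1r -{1}(setIidPr sST) setID.
by rewrite -setI_eq0 setIDA setIC -setIDA setDv setI0.
Qed.

Lemma A_ideal_sub S T x : S \subset T -> A_ideal S x -> A_ideal T x.
Proof.
move=> /subsetP sST; elim=> {x} [_ [a [e [Se ->]]]||x y _ Ix _ Iy|c x _ Ix|x y _ Iy|x y _ Ix].
- by apply: ideal_gen; exists a, e; split=> //; apply: sST.
- exact: ideal0.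
- exact: idealD.
- exact: idealZ.
- exact: ideal_mull.
- exact: ideal_mulr.
Qed.

(** For homogeneous [a] the two terms of a generator have the same degree, so [twist] multiplies the
    generator by a sign; a general [a] is expanded in the homogeneous basis. *)
Lemma A_ideal_twist S d x : A_ideal S x -> A_ideal S (twist d x).
Proof.
elim=> {x} [_ [a [e [Se ->]]]||x y _ Ix _ Iy|c x _ Ix|x y _ Iy|x y _ Ix].
- rewrite tinj_expand [tinj (etgt e) a]tinj_expand -sumrB.
  have -> : \sum_s (gcoord s a *: tinj (esrc e) (gbasis s)
      - gcoord s a *: tinj (etgt e) (gbasis s)) =
    \sum_s gcoord s a *: (tinj (esrc e) (gbasis s) - tinj (etgt e) (gbasis s)) :> tens A n.
    by apply: eq_bigr => s _; rewrite scalerBr.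
  elim/big_rec: _ => [|s y _ Iy]; first by rewrite twist0; apply: ideal0.
  rewrite twist_linear twistB; apply: (idealD _ Iy); apply: idealZ.
  rewrite !(twist_hdeg _ (tinj_hdeg frob (@homog_basis _ _ s))) -scalerBr.
  by apply: idealZ; apply: ideal_gen; exists (gbasis s), e.
- by rewrite twist0; apply: ideal0.
- by rewrite -[x]scale1r twist_linear scale1r; apply: idealD.
- by rewrite twistZ; apply: idealZ.
- by rewrite (twist_tmul frob); apply: ideal_mull.
- by rewrite (twist_tmul frob); apply: ideal_mulr.
Qed.

Lemma A_ideal_conn S i j (a : A) : conn S i j -> A_ideal S (tinj i a - tinj j a).
Proof.
case/connectP => p; elim: p i => [|l p IHp] i /=.
  by move=> _ ->; rewrite subrr; apply: ideal0.
case/andP => /adjP[e Se eil] pl lj.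
rewrite -(subrKA (tinj l a)); apply: idealD (IHp l pl lj).
case/orP: eil => /andP[/eqP<- /eqP<-].
  by apply: ideal_gen; exists a, e.
by rewrite -opprB; apply: idealN; apply: ideal_gen; exists a, e.
Qed.

Lemma A_ideal_tpull S i j i' j' (x : tens A 2) : conn S i i' -> conn S j j' ->
  A_ideal S (tpull i j x - tpull i' j' x).
Proof.
move=> ii' jj'; rewrite /tpull -sumrB; apply: ideal_sum => w _.
rewrite -scalerBr; apply: idealZ.
set b0 := gbasis _; set b1 := gbasis _.
have -> : tmul (tinj i b0) (tinj j b1) - tmul (tinj i' b0) (tinj j' b1) =
    tmul (tinj i b0 - tinj i' b0) (tinj j b1)
    + tmul (tinj i' b0) (tinj j b1 - tinj j' b1).
  by rewrite tmulDl tmulDr tmulNl tmulNr addrA subrK.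
apply: idealD; first by apply: ideal_mulr; apply: A_ideal_conn.
by apply: ideal_mull; apply: A_ideal_conn.
Qed.

Definition gbd S x : pre A G := ext_d (fun T => gterm T x) S.

(* [kerR] is the kernel of the map from [(+)_S G_S (x) A^{(x) n}] to [R]. *)
Inductive ker_gen : pre A G -> Prop :=
  | ker_A S x : A_ideal S x -> ker_gen (gterm S x)
  | ker_cyc S x : cyclic S -> ker_gen (gterm S x)
  | ker_bd S x : cyclic S -> ker_gen (gbd S x).

(** Only a linear span is taken, so that linear maps can be evaluated on generators; that it is a
    two-sided ideal is proved below. *)
Inductive kerR : pre A G -> Prop :=
  | kerR_gen p : ker_gen p -> kerR p
  | kerR_0 : kerR 0
  | kerR_D p q : kerR p -> kerR q -> kerR (p + q)
  | kerR_Z c p : kerR p -> kerR (c *: p).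

Lemma kerR_sum I (r : seq I) (Q : pred I) (F : I -> pre A G) :
  (forall i, Q i -> kerR (F i)) -> kerR (\sum_(i <- r | Q i) F i).
Proof. by move=> kF; elim/big_rec: _ => [|i x Qi]; [exact: kerR_0 | apply/kerR_D/kF]. Qed.

Lemma kerR_N p : kerR p -> kerR (- p).
Proof. by rewrite -scaleN1r; apply: kerR_Z. Qed.

Lemma ext_leibniz_gterm S T x :
  \sum_(e in S) (-1) ^+ epos e S *: (ext_sign k (S :\ e) T *: gterm (S :\ e :|: T) x) =
  ext_sign k S T *: gbd (S :|: T) x -
  (-1) ^+ #|S| *: \sum_(e in T) (-1) ^+ epos e T *:
    (ext_sign k S (T :\ e) *: gterm (S :|: T :\ e) x).
Proof. exact: (ext_leibniz (fun U => gterm U x)). Qed.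

(** For the generators [D(G_S)], the Leibniz rule turns [D(G_S) G_T] into a multiple of [D(G_S G_T)]
    and terms that contain the whole cyclic set [S]. *)
Lemma kerR_mulr p q : kerR p -> kerR (pmul p q).
Proof.
elim/pre_ind: q p => [p _|q q' kq kq' p kp|T y p].
- by rewrite pmul0r; apply: kerR_0.
- by rewrite pmulDr; apply: kerR_D; [apply: kq | apply: kq'].
elim=> {p} [_ [S x|S x|S x]||p q _ kp _ kq|c p _ kp].
- move=> Ix; rewrite pmul_gterm; apply/kerR_Z/kerR_gen/ker_A.
  by apply: ideal_mulr; apply: A_ideal_twist; apply: (A_ideal_sub _ Ix); apply: subsetUl.
- move=> cS; rewrite pmul_gterm; apply/kerR_Z/kerR_gen/ker_cyc.
  by apply: cyclic_sub cS; apply: subsetUl.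
- move=> cS; rewrite /gbd /ext_d pmul_suml.
  under eq_bigr do rewrite pmulZl pmul_gterm.
  rewrite ext_leibniz_gterm; apply: kerR_D.
    by apply/kerR_Z/kerR_gen/ker_bd; apply: cyclic_sub cS; apply: subsetUl.
  apply/kerR_N/kerR_Z/kerR_sum => e Te; apply/kerR_Z/kerR_Z/kerR_gen/ker_cyc.
  by apply: cyclic_sub cS; apply: subsetUl.
- by rewrite pmul0l; apply: kerR_0.
- by rewrite pmulDl; apply: kerR_D.
- by rewrite pmulZl; apply: kerR_Z.
Qed.

Lemma kerR_mull p q : kerR p -> kerR (pmul q p).
Proof.
elim/pre_ind: q p => [p _|q q' kq kq' p kp|T y p].
- by rewrite pmul0l; apply: kerR_0.
- by rewrite pmulDl; apply: kerR_D; [apply: kq | apply: kq'].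
elim=> {p} [_ [S x|S x|S x]||p q _ kp _ kq|c p _ kp].
- move=> Ix; rewrite pmul_gterm; apply/kerR_Z/kerR_gen/ker_A.
  by apply: ideal_mull; apply: (A_ideal_sub _ Ix); apply: subsetUr.
- move=> cS; rewrite pmul_gterm; apply/kerR_Z/kerR_gen/ker_cyc.
  by apply: cyclic_sub cS; apply: subsetUr.
- move=> cS; rewrite /gbd /ext_d pmul_sumr.
  (* Every [S :\ e] has the same number of edges, so moving [y] past its generator twists [y] in the
     same way in all terms. *)
  pose z := tmul (twist ((m%:Z - 1) * #|S|.-1%:Z) y) x.
  have -> : \sum_(e in S) pmul (gterm T y) ((-1) ^+ epos e S *: gterm (S :\ e) x) =
      \sum_(e in S) (-1) ^+ epos e S *:
        (ext_sign k T (S :\ e) *: gterm (T :|: S :\ e) z).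
    by apply: eq_bigr => e Se; rewrite pmulZr pmul_gterm /z (cardsD1 e S) Se.
  rewrite (ext_leibniz_r (fun U => gterm U z)).
  apply: kerR_Z; apply: kerR_D.
    by apply/kerR_Z/kerR_gen/ker_bd; apply: cyclic_sub cS; apply: subsetUr.
  apply/kerR_N/kerR_sum => e Te; apply/kerR_Z/kerR_Z/kerR_gen/ker_cyc.
  by apply: cyclic_sub cS; apply: subsetUr.
- by rewrite pmul0r; apply: kerR_0.
- by rewrite pmulDr; apply: kerR_D.
- by rewrite pmulZr; apply: kerR_Z.
Qed.

(* The left-hand side of the generalised Arnold relation for a list of edges. *)
Definition gprod (s : seq (edge G)) : pre A G :=
  foldr (fun e p => pmul (gedge A e) p) (pone A G) s.
Definition arnold (s : seq (edge G)) : pre A G :=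
  \sum_(f <- s) (-1) ^+ index f s *: gprod [seq g <- s | g != f].

(** The sign of the permutation that sorts [s] into ascending order; zero if [s] has a
    repetition. *)
Fixpoint sort_sign (s : seq (edge G)) : k :=
  if s is e :: s' then ext_sign k [set e] [set:: s'] * sort_sign s' else 1.

Lemma sort_sign_sq s : uniq s -> sort_sign s * sort_sign s = 1.
Proof.
elim: s => [|e s IHs] /=; first by rewrite mulr1.
case/andP => es us; rewrite mulrACA IHs // mulr1 ext_sign_sq //.
by rewrite disjoints1 inE.
Qed.

Lemma gprodE s : gprod s = sort_sign s *: gterm [set:: s] (tone A n).
Proof.
elim: s => [|e s IHs] /=.
  by rewrite scale1r /gprod /= /pone; congr gterm; apply/setP => f; rewrite !inE.
rewrite -/(gprod s) IHs pmulZr /gedge pmul_ext_gterm scalerA mulrC.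
by congr (_ *: gterm _ _); apply/setP => f; rewrite !inE.
Qed.

(** Both sides satisfy the recursion [X (e :: s) = G_s - G_e X s], which for [D] is [ext_leibniz1].
    So the Arnold relation of a circuit [C] is [D(G_C)] up to sign. *)
Lemma arnoldE s : uniq s -> arnold s = sort_sign s *: gbd [set:: s] (tone A n).
Proof.
elim: s => [|e s IHs] us.
  by rewrite /arnold big_nil /gbd /ext_d big_pred0 ?scaler0 // => f; rewrite !inE.
case/andP: (us) => es us'; rewrite /arnold big_cons /= !eqxx expr0 scale1r.
have -> : [seq g <- s | g != e] = s.
  by apply/all_filterP/allP => g; apply: contraTneq => ->.
have -> : \sum_(f <- s) (-1) ^+ index f (e :: s) *:
    gprod (if e != f then e :: [seq g <- s | g != f] else [seq g <- s | g != f]) =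
  - pmul (gedge A e) (arnold s).
  rewrite /arnold pmul_sumr -sumrN; apply: eq_big_seq => f fs /=.
  have -> : e != f by apply: contraNneq es => ->.
  case: eqP => [E|_]; first by rewrite E fs in es.
  by rewrite pmulZr exprS mulN1r scaleNr.
rewrite IHs // pmulZr gprodE.
rewrite {1}(ext_leibniz1 (fun U => gterm U (tone A n)) e [set:: s]).
have <- : \sum_(f in [set:: s]) (-1) ^+ epos f [set:: s] *:
      (ext_sign k [set e] ([set:: s] :\ f) *: gterm (e |: [set:: s] :\ f) (tone A n))
    = pmul (gedge A e) (gbd [set:: s] (tone A n)).
  rewrite /gbd /ext_d pmul_sumr; apply: eq_bigr => f sf.
  by rewrite pmulZr /gedge pmul_ext_gterm.
rewrite scalerDr addrK scalerA mulrC.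
by congr (_ *: gbd _ _); apply/setP => f; rewrite !inE.
Qed.
End PreAlgebra.

(** * The ideal of relations of R coincides with [kerR] *)

Section ArnoldRelations.
Variables (k : comPzRingType) (A : graded_algebra k) (m : nat).
Variables (pairing : A -> A -> k) (frob : frobenius m pairing).
Variables (n : nat) (G : graph n).
Implicit Types (S T U C : {set edge G}) (e f : edge G) (x y z : tens A n).
Implicit Types (p q : pre A G).
Notation pmul := (@pmul k A m n G).
Notation rideal := (ideal pmul (@R_relation k A m n G)).

Lemma ordSE c (i : 'I_c) : ordS i = (if (i.+1 < c)%N then i.+1 else 0%N) :> nat.
Proof.
rewrite /=; case: ltnP => [/modn_small//|ci].
by have -> : i.+1 = c; [apply/eqP; rewrite eqn_leq ci ltn_ord | rewrite modnn].
Qed.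

Section Cycle.
Variables (c : nat) (v : 'I_c -> 'I_n) (e : 'I_c -> edge G).
Hypotheses (c3 : (3 <= c)%N) (v_inj : injective v).
Hypothesis (ev : forall i, joins (e i) (v i) (v (ordS i))).

(** If [e i = e j] with ends matched crosswise, [i] and [j] are successors of each other modulo [c],
    which would force [c <= 2]. *)
Lemma cycle_edges_inj : injective e.
Proof.
move=> i j eij; have := ev i; rewrite eij; have := ev j; rewrite /joins.
have swap : v i = v (ordS j) -> v (ordS i) = v j -> i = j.
  move=> /v_inj E1 /v_inj E2; apply: val_inj => /=.
  move: (congr1 (@nat_of_ord c) E1) (congr1 (@nat_of_ord c) E2); rewrite !ordSE.
  by have := ltn_ord j; do 2!case: ifP; lia.
case/orP => /andP[/eqP Es /eqP Et] /orP[] /andP[/eqP Es' /eqP Et'].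
- by apply: v_inj; rewrite -Es' Es.
- by apply: swap; [rewrite -Et' Et | rewrite -Es' Es].
- by apply: swap; [rewrite -Es' Es | rewrite -Et' Et].
- by apply: v_inj; rewrite -Et' Et.
Qed.

Definition cycle_edges : seq (edge G) := map e (enum 'I_c).

Lemma cycle_edges_uniq : uniq cycle_edges.
Proof. by rewrite map_inj_uniq ?enum_uniq //; apply: cycle_edges_inj. Qed.

Lemma mem_cycle_edges i : e i \in cycle_edges.
Proof. by apply: map_f; rewrite mem_enum. Qed.

(** Without its edge of index 0 the cycle is still a path from vertex 1 around to vertex 0, so that
    edge is internal. *)
Lemma cycle_cyclic : cyclic [set:: cycle_edges].
Proof.
have c0 : (0 < c)%N by apply: leq_trans c3.
pose i0 := Ordinal c0; pose C := [set:: cycle_edges] :\ e i0.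
have step i : i != i0 -> conn C (v i) (v (ordS i)).
  move=> ne; apply: (conn_joins _ (ev i)).
  by rewrite !inE mem_cycle_edges (inj_eq cycle_edges_inj) ne.
have reach t (i : 'I_c) : i = t.+1 :> nat -> conn C (v (ordS i0)) (v i).
  elim: t i => [|t IHt] i it.
    have -> : i = ordS i0; last exact: conn0.
    by apply: val_inj; rewrite /= it modn_small //; apply: leq_trans c3.
  have tc : (t.+1 < c)%N by rewrite ltnW // -it.
  have -> : i = ordS (Ordinal tc).
    by apply: val_inj; rewrite /= modn_small -?it.
  exact: conn_trans (IHt (Ordinal tc) erefl) (step _ _).
have c1 : (c.-1 < c)%N by rewrite prednK.
have back : conn C (v (ordS i0)) (v i0).
  have [t ct] : exists t, c.-1 = t.+1 by case: (c) c3 => [|[|[|t]]] //; exists t.+1.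
  apply: (conn_trans (reach t (Ordinal c1) ct)).
  have -> : i0 = ordS (Ordinal c1) by apply: val_inj; rewrite /= prednK // modnn.
  by apply: step; rewrite -val_eqE /= ct.
apply: (@bridged_cyclic _ _ _ (e i0)); first by rewrite inE mem_cycle_edges.
rewrite /bridged -/C; have := ev i0; rewrite /joins.
by case/orP => /andP[/eqP-> /eqP->]; rewrite 1?connC // connC.
Qed.

Lemma arnold_cycle : \sum_(i < c) (-1) ^+ i *:
    \big[pmul/pone A G]_(j < c | j != i) gedge A (e j) = arnold A m cycle_edges.
Proof.
rewrite /arnold big_map big_enum; apply: eq_bigr => i _; congr (_ ^+ _ *: _).
  by rewrite index_map ?index_enum_ord //; apply: cycle_edges_inj.
rewrite filter_map (eq_filter (a2 := fun j => j != i)) => [|j]; last first.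
  by rewrite /= (inj_eq cycle_edges_inj).
by rewrite /gprod foldr_map enumT -big_filter unlock.
Qed.
End Cycle.

Lemma pmul_gedge1 e : pmul (gedge A e) (pone A G) = gedge A e.
Proof. by rewrite -/(pin G (tone A n)) pmul_gterm_pin (tmul1l frob). Qed.

(** The Arnold expression of length two is the relation between parallel edges. *)
Lemma arnold_pair e f : e != f -> arnold A m [:: f; e] = gedge A e - gedge A f.
Proof.
move=> ne; rewrite /arnold big_cons big_seq1 /= !eqxx /= (negbTE ne) eq_sym (negbTE ne) /=.
by rewrite !pmul_gedge1 expr0 expr1 scale1r scaleN1r.
Qed.

Lemma R_relation_kerR p : R_relation m p -> kerR p.
Proof.
case=> {p} [e f es et|e a|c v e c3 v_inj ev].
- have [->|ne] := eqVneq e f; first by rewrite subrr; apply: kerR_0.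
  rewrite -arnold_pair // (arnoldE frob) ?andbT /=; last by rewrite inE eq_sym ne.
  apply/kerR_Z/kerR_gen/ker_bd; apply: (@bridged_cyclic _ _ _ e).
    by rewrite !inE eqxx orbT.
  apply: (@conn_joins _ _ _ f); first by rewrite !inE eq_sym ne eqxx.
  by rewrite /joins es et !eqxx.
- rewrite /gedge !pmul_pin_gterm -gtermB -tmulNl -tmulDl -twistB.
  apply/kerR_gen/ker_A; apply: ideal_mulr; apply: (A_ideal_twist frob).
  by apply: ideal_gen; exists a, e; rewrite inE eqxx.
- rewrite (arnold_cycle c3 v_inj ev) (arnoldE frob); last exact: cycle_edges_uniq c3 v_inj ev.
  by apply/kerR_Z/kerR_gen/ker_bd; apply: cycle_cyclic c3 v_inj ev.
Qed.

Lemma rideal_kerR p : rideal p -> kerR p.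
Proof.
elim=> {p} [p||p q _ kp _ kq|c p _ kp|p q _ kq|p q _ kp].
- exact: R_relation_kerR.
- exact: kerR_0.
- exact: kerR_D.
- exact: kerR_Z.
- exact: kerR_mull.
- exact: (kerR_mulr frob).
Qed.

Lemma path_edges S (x : 'I_n) (s : seq 'I_n) e : path (adj S) x s ->
  exists es : seq (edge G), [/\ size es = size s, {subset es <= S} &
    forall i, (i < size s)%N -> joins (nth e es i) (nth x (x :: s) i) (nth x s i)].
Proof.
elim: s x => [|y s IHs] x /=; first by exists [::].
case/andP => /adjP[f Sf fxy] /IHs[es [ses sub nes]].
exists (f :: es); split=> [|g|[|i]]; rewrite /= ?ses //.
  by rewrite inE => /orP[/eqP->|/sub].
rewrite ltnS => is_; have := nes i is_.
rewrite /= (set_nth_default x) 1?(set_nth_default x (s := s)) //.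
by rewrite ltnS ltnW.
Qed.

(** In a minimal cyclic subset, a shortest form of the walk joining the ends of [e] without [e] has
    distinct vertices and is closed up by [e]. Length zero is impossible since [e] is no loop,
    length one is a parallel edge and falls under [rel_sym], and longer paths give an instance of
    [rel_arnold]. *)
Lemma circuit_rideal S : cyclic S -> exists C : {set edge G},
  [/\ C \subset S, exists e, e \in C & rideal (gbd C (tone A n))].
Proof.
case/cyclic_circuit => C0 /subsetP sC0S [[e C0e] /(_ e C0e)].
case/connectP => s0 s0path; case/shortenP: s0path => s ps us _ ls.
have [es [ses sub nes]] := path_edges e ps.
have nst : esrc e != etgt e by rewrite -val_eqE neq_ltn esrc_etgt.
case: s ses nes ls us {ps} => [|y [|y' s]] ses nes /= ls us.
- by rewrite ls eqxx in nst.
- case: es ses nes sub => [|f []] // _ /(_ 0%N isT) /=; rewrite -ls => jf sub.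
  have := sub f (mem_head _ _); rewrite !inE => /andP[fe C0f].
  have [fs ft] : esrc f = esrc e /\ etgt f = etgt e.
    case/orP: jf => /andP[/eqP Es /eqP Et] //.
    by have := esrc_etgt f; rewrite Es Et ltnNge ltnW // esrc_etgt.
  exists [set f; e]; split.
  + by apply/subsetP => g; rewrite !inE => /orP[]/eqP->; apply: sC0S.
  + by exists e; rewrite !inE eqxx orbT.
  + have uf : uniq [:: f; e] by rewrite /= inE fe.
    have : rideal (arnold A m [:: f; e]).
      by rewrite arnold_pair 1?eq_sym //; apply/ideal_gen/rel_sym.
    rewrite (arnoldE frob) // => /(idealZ (sort_sign k [:: f; e])).
    rewrite scalerA sort_sign_sq // scale1r.
    by have -> : [set:: [:: f; e]] = [set f; e] by apply/setP => g; rewrite !inE.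
- set vs := [:: esrc e, y, y' & s]; pose c := size vs.
  (* The path has [c - 1] edges; [e], at index [c - 1], leads from the last vertex [etgt e] back to
     vertex 0, which is [esrc e]. *)
  pose v (i : 'I_c) := nth (esrc e) vs i; pose ee (i : 'I_c) := nth e (rcons es e) i.
  have v_inj : injective v.
    by move=> i j /eqP; rewrite nth_uniq // => /eqP/val_inj.
  have ses' : size es = (size s).+2 by [].
  have ev i : joins (ee i) (v i) (v (ordS i)).
    rewrite /ee nth_rcons /v ordSE ses' -[(i.+1 < c)%N]/(i < (size s).+2)%N.
    case: ltnP => [is_|si]; first exact: (nes i is_).
    have -> : nat_of_ord i = (size s).+2.
      by apply/eqP; rewrite eqn_leq si andbT -ltnS ltn_ord.
    rewrite eqxx [nth _ _ 0]/=; have -> : nth (esrc e) vs (size s).+2 = etgt e.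
      by rewrite ls -[(size s).+2]/(size [:: esrc e, y, y' & s]).-1 nth_last.
    by rewrite joinsC joins_ends.
  have c3 : (3 <= c)%N by [].
  have ue := cycle_edges_uniq c3 v_inj ev.
  exists [set:: cycle_edges ee]; split.
  + apply/subsetP => g; rewrite inE => /mapP[i _ ->]; apply: sC0S.
    rewrite /ee nth_rcons; case: ltnP => [/(mem_nth e)/sub|_].
      by rewrite !inE => /andP[].
    by rewrite if_same.
  + exists e; rewrite inE; apply/mapP; exists ord_max; rewrite ?mem_enum //.
    by rewrite /ee nth_rcons /= ses' ltnn eqxx.
  + have : rideal (arnold A m (cycle_edges ee)).
      by rewrite -(arnold_cycle c3 v_inj ev); apply/ideal_gen/rel_arnold/ev.
    rewrite (arnoldE frob) // => /(idealZ (sort_sign k (cycle_edges ee))).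
    by rewrite scalerA sort_sign_sq // scale1r.
Qed.

(** Since [G_e G_C = 0], [ext_leibniz1] gives [G_C = G_e D(G_C)], and [G_U] is a multiple of
    [G_C]. *)
Lemma rideal_circuit C U e x : e \in C -> C \subset U ->
  rideal (gbd C (tone A n)) -> rideal (gterm U x).
Proof.
move=> Ce sCU IC; rewrite (gterm_split frob x sCU); apply: idealZ; apply: ideal_mulr.
rewrite (ext_leibniz1 (fun T => gterm T (tone A n)) e C).
rewrite {1}/ext_sign disjoints1 Ce scale0r add0r.
have -> : \sum_(f in C) (-1) ^+ epos f C *:
      (ext_sign k [set e] (C :\ f) *: gterm (e |: C :\ f) (tone A n))
    = pmul (gedge A e) (gbd C (tone A n)).
  rewrite /gbd /ext_d pmul_sumr; apply: eq_bigr => f _.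
  by rewrite pmulZr /gedge (pmul_ext_gterm frob).
exact: ideal_mull.
Qed.

Lemma rideal_cyclic S x : cyclic S -> rideal (gterm S x).
Proof. by case/circuit_rideal => C [sCS [e Ce]]; apply: rideal_circuit Ce sCS. Qed.

(** Write [G_S] as [G_C G_T] up to sign. In the Leibniz expansion one part is a multiple of
    [D(G_C)], and every term of the other contains [C]. *)
Lemma rideal_bd S x : cyclic S -> rideal (gbd S x).
Proof.
case/circuit_rideal => C [sCS [e Ce] IC]; set T := S :\: C.
have dCT : [disjoint C & T] by rewrite -setI_eq0 setIDA setIC -setIDA setDv setI0.
have CT : C :|: T = S by rewrite -{1}(setIidPr sCS) setID.
have -> : gbd S x = ext_sign k C T *: (pmul (gbd C (tone A n)) (gterm T x)
    + (-1) ^+ #|C| *: \sum_(e in T) (-1) ^+ epos e T *: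
        (ext_sign k C (T :\ e) *: gterm (C :|: T :\ e) x)).
  rewrite -{1}CT {1}/gbd (ext_d_setU _ dCT) /gbd /ext_d pmul_suml.
  by under [in RHS]eq_bigr do rewrite pmulZl (pmul_ext_gterm frob).
apply: idealZ; apply: idealD; first exact: ideal_mulr.
apply: idealZ; apply: ideal_sum => f _; apply/idealZ/idealZ.
by apply: (rideal_circuit _ Ce _ IC); apply: subsetUl.
Qed.

Lemma rideal_A S x : A_ideal S x -> rideal (gterm S x).
Proof.
elim=> {x} [_ [a [e [Se ->]]]||x y _ Ix _ Iy|c x _ Ix|x y _ Iy|x y _ Ix].
- have sS : S :\ e \subset S by apply: subD1set.
  rewrite (gterm_split frob _ sS); apply: idealZ; apply: ideal_mull.
  have -> : S :\: (S :\ e) = [set e].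
    by apply/setP => f; rewrite !inE; case: eqVneq => [->|] //=; rewrite ?Se // andNb.
  rewrite tinj_expand [tinj (etgt e) a]tinj_expand -sumrB gterm_sum.
  apply: ideal_sum => s _; rewrite -scalerBr gtermZ; apply: idealZ.
  (* [rel_move] has the coefficient to the left of [G_e]. For a basis element, moving it to the
     right costs the same sign in both terms. *)
  have h i : hdeg (gdeg s) (tinj i (gbasis s) : tens A n).
    exact: (tinj_hdeg frob (@homog_basis k A s)).
  pose a0 := absz ((m%:Z - 1) * #|[set e]|%:Z * (gdeg s)%:Z).
  apply: (@ideal_signZ _ _ _ _ a0).
  have := @rel_move k A m n G e (gbasis s).
  rewrite /gedge !pmul_pin_gterm !(twist_hdeg _ (h _)) -/a0.
  have ev : even_tens (tone A n) by move=> w /(tone_hdeg frob)->.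
  rewrite !tmulZl -!(tmul_evenC frob _ ev) !(tmul1l frob) !gtermZ -scalerBr -gtermB.
  exact: ideal_gen.
- by rewrite gterm0; apply: ideal0.
- by rewrite gtermD; apply: idealD.
- by rewrite gtermZ; apply: idealZ.
(* Twisting is an involution, so a pre-twisted left factor passes [G_S] and arrives as [x]. *)
- set d := (m%:Z - 1) * #|S|%:Z.
  have -> : x = twist d (twist d x).
    by apply: tensP => w; rewrite !ffunE mulrA -expr2 sqrr_sign mul1r.
  by rewrite -pmul_pin_gterm; apply: ideal_mull.
- by rewrite -(pmul_gterm_pin m); apply: ideal_mulr.
Qed.

Lemma kerR_rideal p : kerR p -> rideal p.
Proof.
elim=> {p} [_ [S x|S x|S x]||p q _ Ip _ Iq|c p _ Ip].
- exact: rideal_A.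
- exact: rideal_cyclic.
- exact: rideal_bd.
- exact: ideal0.
- exact: idealD.
- exact: idealZ.
Qed.
End ArnoldRelations.

Lemma sign_cancel (R : pzRingType) a b :
  odd a = ~~ odd b -> (-1) ^+ a + (-1) ^+ b = 0 :> R.
Proof.
rewrite -(signr_odd _ a) -(signr_odd _ b) => ->.
by case: odd; rewrite ?expr0 ?expr1 ?subrr ?addNr.
Qed.

(** * The acyclic part of the graph complex *)

Section GraphComplex.
Variables (k : comPzRingType) (A : graded_algebra k) (m : nat).
Variables (pairing : A -> A -> k) (frob : frobenius m pairing).
Variables (m_even : ~~ odd m) (n : nat) (G : graph n).
Variables (Delta : tens A 2) (diag : diagonal_class pairing Delta).
Implicit Types (S T U : {set edge G}) (e f : edge G) (x y z : tens A n).
(* [C_BS], presented by its class map and a choice of representatives. *)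
Variables (C : lmodType k) (cl : {linear pre A G -> C}) (BS_rep : C -> pre A G).
Hypothesis (BS_repK : cancel BS_rep cl).
Hypothesis (BS_classP : forall p p',
  cl p = cl p' <-> forall S, A_ideal S (p S - p' S)).
Implicit Types (p : pre A G) (q : C) (c : k).
Notation "'D_' e" := (tpull (esrc e) (etgt e) Delta) (at level 9).

Lemma cl0 : cl 0 = 0. Proof. exact: raddf0. Qed.
Lemma clD p p' : cl (p + p') = cl p + cl p'. Proof. exact: raddfD. Qed.
Lemma clZ c p : cl (c *: p) = c *: cl p. Proof. exact: linearZ. Qed.
Lemma cl_sum I (r : seq I) (P : pred I) (F : I -> pre A G) :
  cl (\sum_(i <- r | P i) F i) = \sum_(i <- r | P i) cl (F i).
Proof. exact: raddf_sum. Qed.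

Lemma BS_class_gterm S x y : A_ideal S (x - y) -> cl (gterm S x) = cl (gterm S y).
Proof.
move=> Ixy; apply/BS_classP => T; rewrite !gtermE; case: eqP => [->//|_].
by rewrite subrr; apply: ideal0.
Qed.

Lemma BS_expand q : q = \sum_S cl (gterm S (BS_rep q S)).
Proof. by rewrite -cl_sum -pre_expand BS_repK. Qed.

Lemma BS_ind (P : C -> Prop) : P 0 -> (forall q q', P q -> P q' -> P (q + q')) ->
  (forall S x, P (cl (gterm S x))) -> forall q, P q.
Proof.
move=> P0 PD Pg q; rewrite [q]BS_expand.
by elim/big_rec: _ => // S q' _; apply: PD.
Qed.

(** The condition does not depend on the representative, by [supp_class]. *)
Definition supp (P : pred {set edge G}) q : Prop :=
  forall S, ~~ P S -> A_ideal S (BS_rep q S).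

Lemma supp_class (P : pred {set edge G}) p :
  (forall S, ~~ P S -> A_ideal S (p S)) -> supp P (cl p).
Proof.
move=> Ip S nPS; have /BS_classP/(_ S) := BS_repK (cl p).
by move=> /idealD/(_ (Ip S nPS)); rewrite subrK.
Qed.

Section Support.
Variable P : pred {set edge G}.

Lemma supp0 : supp P 0.
Proof.
rewrite -cl0; apply: supp_class => S _; rewrite pre0E; exact: ideal0.
Qed.

Lemma suppD q q' : supp P q -> supp P q' -> supp P (q + q').
Proof.
move=> Iq Iq'; rewrite -[q]BS_repK -[q']BS_repK -clD.
by apply: supp_class => S nPS; rewrite preDE; apply: idealD; [apply: Iq|apply: Iq'].
Qed.

Lemma suppZ c q : supp P q -> supp P (c *: q).
Proof.
move=> Iq; rewrite -[q]BS_repK -clZ.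
by apply: supp_class => S nPS; rewrite preZE; apply: idealZ; apply: Iq.
Qed.

Lemma suppN q : supp P q -> supp P (- q).
Proof. by rewrite -scaleN1r; apply: suppZ. Qed.

Lemma suppB q q' : supp P q -> supp P q' -> supp P (q - q').
Proof. by move=> Iq /suppN; apply: suppD. Qed.

Lemma supp_sum I (r : seq I) (Q : pred I) (F : I -> C) :
  (forall i, Q i -> supp P (F i)) -> supp P (\sum_(i <- r | Q i) F i).
Proof. by move=> sF; elim/big_rec: _ => [|i x Qi]; [exact: supp0 | apply/suppD/sF]. Qed.

Lemma supp_gterm S x : P S -> supp P (cl (gterm S x)).
Proof.
move=> PS; apply: supp_class => T nPT; rewrite gtermE.
by case: eqP nPT => [->|_ _]; [rewrite PS | apply: ideal0].
Qed.

Lemma supp_expand q : supp P q -> q = \sum_(S | P S) cl (gterm S (BS_rep q S)).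
Proof.
move=> sq; rewrite {1}[q]BS_expand (bigID P) /= [X in _ + X]big1 ?addr0 // => S nPS.
rewrite -cl0 -(gterm0 A S); apply: BS_class_gterm.
by rewrite subr0; apply: sq.
Qed.
End Support.

Lemma supp_pred0 q : supp pred0 q -> q = 0.
Proof. by move/supp_expand->; rewrite big_pred0. Qed.

(* The endomorphism of [A^{(x) n}] inducing [delta_e] on [G_S (x) A_S]. *)
Definition theta S e x : tens A n :=
  if bridged (S :\ e) e then x else tmul (D_ e) x.

Lemma tpull_comm (i j i' j' : 'I_n) x :
  tmul (tpull i j Delta) (tmul (tpull i' j' Delta) x) =
  tmul (tpull i' j' Delta) (tmul (tpull i j Delta) x).
Proof.
have ev := @tpull_even _ _ _ _ frob m_even _ diag n i j.
by rewrite !(tmulA frob) (tmul_evenC frob (tpull i' j' Delta) ev).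
Qed.

Lemma A_ideal_refl S x : A_ideal S (x - x).
Proof. by rewrite subrr; apply: ideal0. Qed.

(** If neither edge affects the other, the two operations commute because [Delta] is even. Otherwise
    the two orders give [D_f x] and [D_e x]; any path joining the ends of [e] in [S :\ e] runs
    through [f], so without both edges the ends of [e] and [f] are connected in pairs and the two
    pullbacks of [Delta] agree, by its symmetry if the pairing is crosswise. *)
Lemma theta_comm S e f x : e \in S -> f \in S -> e != f ->
  A_ideal (S :\ e :\ f) (theta (S :\ e) f (theta S e x) - theta (S :\ f) e (theta S f x)).
Proof.
move=> Se Sf ef; have Sef : f \in S :\ e by rewrite !inE eq_sym ef.
have Sfe : e \in S :\ f by rewrite !inE ef.
have UC : S :\ f :\ e = S :\ e :\ f by apply/setP => g; rewrite !inE andbCA.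
rewrite /theta UC; case: (bridged_swap Se Sf ef) => [[-> ->]|[-> nbe -> be]].
  set y := (X in A_ideal _ (X - _)); set z := (X in A_ideal _ (_ - X)).
  suff -> : y = z by exact: A_ideal_refl.
  rewrite /y /z; case: bridged; case: bridged; [reflexivity .. |].
  exact: tpull_comm.
rewrite nbe be -tmulNl -tmulDl; apply: ideal_mulr.
have : conn (f |: S :\ e :\ f) (esrc e) (etgt e) by rewrite setD1K.
rewrite conn_setU1 -/(bridged _ e) nbe /=.
case/orP => /andP[c1 c2]; last rewrite (tpull_sym frob m_even diag (esrc f)).
  by apply: A_ideal_tpull => //; rewrite connC.
by apply: A_ideal_tpull => //; rewrite connC.
Qed.

(** The terms are cancelled in pairs [f < e]; exchanging the two sums would only show that twice the
    total is zero. *)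
Lemma antisym_sum (V : zmodType) S (F : edge G -> edge G -> V) :
  (forall e f, e \in S -> f \in S -> e != f -> F e f = - F f e) ->
  \sum_(e in S) \sum_(f in S :\ e) F e f = 0.
Proof.
move=> aF.
have -> : \sum_(e in S) \sum_(f in S :\ e) F e f =
    \sum_(e in S) \sum_(f in S | (f < e)%N) F e f +
    \sum_(e in S) \sum_(f in S | (e < f)%N) F e f.
  rewrite -big_split; apply: eq_bigr => e Se /=.
  rewrite (bigID (fun f : edge G => (f < e)%N)) /=; congr (_ + _); apply: eq_bigl => f.
    by rewrite !inE; case: (eqVneq f e) => [->|]; rewrite ?ltnn ?andbF.
  rewrite !inE -leqNgt ltn_neqAle -(inj_eq val_inj) eq_sym.
  by rewrite [RHS]andbC [LHS]andbAC.
have -> : \sum_(e in S) \sum_(f in S | (e < f)%N) F e f =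
    \sum_(e in S) \sum_(f in S | (f < e)%N) F f e.
  rewrite (exchange_big_dep (mem S)) /=; last by move=> e f _ /andP[].
  by apply: eq_bigr => e Se; apply: eq_bigl => f; rewrite Se.
rewrite -big_split big1 //= => e Se; rewrite -big_split big1 //= => f /andP[Sf fe].
by rewrite aF ?addNr // -val_eqE neq_ltn fe orbT.
Qed.

(** * The contractions and the exactness of the cyclic part *)

Section Differential.
Variables (delta : {linear C -> C}).
Hypothesis (deltaE : forall S x, delta (cl (gterm S x)) =
  \sum_(e in S) (-1) ^+ epos e S *: cl (gterm (S :\ e) (theta S e x))).

Lemma epos_swap S e f : e \in S -> f \in S -> e != f ->
  odd (epos e S + epos f (S :\ e)) = ~~ odd (epos f S + epos e (S :\ f)).
Proof.
move=> Se Sf ef; rewrite (eposD1 e Sf) (eposD1 f Se) !oddD !oddb.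
have : (e : nat) != f by rewrite val_eqE.
by case: ltngtP => // _ _; do 2!case: odd.
Qed.

Lemma delta_sq q : delta (delta q) = 0.
Proof.
elim/BS_ind: q => [|q q' Eq Eq'|S x]; first by rewrite !linear0.
  by rewrite !linearD Eq Eq' addr0.
rewrite deltaE linear_sum.
pose F e f := (-1) ^+ (epos e S + epos f (S :\ e)) *:
  cl (gterm (S :\ e :\ f) (theta (S :\ e) f (theta S e x))).
rewrite -[RHS](@antisym_sum _ S F) => [|e f Se Sf ef].
  apply: eq_bigr => e Se; rewrite linearZ /= deltaE scaler_sumr.
  by apply: eq_bigr => f _; rewrite scalerA -exprD.
have -> : F f e = (-1) ^+ (epos f S + epos e (S :\ f)) *:
    cl (gterm (S :\ e :\ f) (theta (S :\ e) f (theta S e x))).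
  have UC : S :\ f :\ e = S :\ e :\ f by apply/setP => g; rewrite !inE andbCA.
  move: (BS_class_gterm (theta_comm x Se Sf ef)); rewrite /F UC.
  by move: (theta (S :\ e) f _) (theta (S :\ f) e _) => a b ->.
rewrite -scaleNr /F; congr (_ *: _); rewrite -[RHS]mulN1r -exprS.
by apply: sign_parity; rewrite /= epos_swap.
Qed.

(** The sign is the one with which [delta] removes [e] from [e |: S], so this removal gives back
    [G_S (x) x]. *)
Definition hterm e S x : C :=
  if (e \notin S) && active S e then (-1) ^+ epos e S *: cl (gterm (e |: S) x) else 0.

Definition htpy e q : C := \sum_S hterm e S (BS_rep q S).

Lemma hterm_linear e S c x y :
  hterm e S (c *: x + y) = c *: hterm e S x + hterm e S y.
Proof.
rewrite /hterm; case: ifP => _; last by rewrite scaler0 addr0.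
by rewrite gterm_linear clD clZ scalerDr !scalerA mulrC.
Qed.

Lemma hterm0 e S : hterm e S 0 = 0.
Proof. by rewrite /hterm gterm0 cl0 scaler0 if_same. Qed.

Lemma hterm_ideal e S x y : A_ideal S (x - y) -> hterm e S x = hterm e S y.
Proof.
move=> Ixy; rewrite /hterm; case: ifP => // _; congr (_ *: _).
by apply: BS_class_gterm; apply: A_ideal_sub Ixy; apply: subsetUr.
Qed.

Lemma htpy_class e p : htpy e (cl p) = \sum_S hterm e S (p S).
Proof.
apply: eq_bigr => S _; apply: hterm_ideal.
by have /BS_classP := BS_repK (cl p).
Qed.

Lemma htpy_linear e c q q' : htpy e (c *: q + q') = c *: htpy e q + htpy e q'.
Proof.
rewrite -[q]BS_repK -[q']BS_repK -clZ -clD !htpy_class.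
rewrite scaler_sumr -big_split; apply: eq_bigr => S _.
by rewrite preDE preZE hterm_linear.
Qed.

Lemma htpy0 e : htpy e 0 = 0.
Proof. by rewrite -[in LHS]cl0 htpy_class big1 // => S _; rewrite pre0E hterm0. Qed.

Lemma htpyD e q q' : htpy e (q + q') = htpy e q + htpy e q'.
Proof. by rewrite -[q]scale1r htpy_linear !scale1r. Qed.

Lemma htpyZ e c q : htpy e (c *: q) = c *: htpy e q.
Proof. by rewrite -[c *: q]addr0 htpy_linear htpy0 addr0. Qed.

Lemma htpy_sum e I (r : seq I) (P : pred I) (F : I -> C) :
  htpy e (\sum_(i <- r | P i) F i) = \sum_(i <- r | P i) htpy e (F i).
Proof. by elim/big_rec2: _ => [|i ? ? _ <-]; rewrite ?htpy0 ?htpyD. Qed.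

Lemma htpy_gterm e S x : htpy e (cl (gterm S x)) = hterm e S x.
Proof.
rewrite htpy_class (bigD1 S) //= gtermE eqxx big1 ?addr0 // => T ne.
by rewrite gtermE (negbTE ne) hterm0.
Qed.

Lemma htpy_delta e S x : htpy e (delta (cl (gterm S x))) =
  \sum_(f in S) (-1) ^+ epos f S *: hterm e (S :\ f) (theta S f x).
Proof.
by rewrite deltaE htpy_sum; apply: eq_bigr => f _; rewrite htpyZ htpy_gterm.
Qed.

Lemma htpy_identity e q :
  supp (fun T => ~~ active T e) (delta (htpy e q) + htpy e (delta q) - q).
Proof.
elim/BS_ind: q => [|q q' sq sq'|S x].
- rewrite !(htpy0, linear0 delta) subr0 addr0; exact: supp0.
- have -> : delta (htpy e (q + q')) + htpy e (delta (q + q')) - (q + q') =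
      (delta (htpy e q) + htpy e (delta q) - q) +
      (delta (htpy e q') + htpy e (delta q') - q').
    by rewrite htpyD !(linearD delta) htpyD opprD [X in X + (- q - q')]addrACA [LHS]addrACA.
  exact: suppD.
rewrite htpy_gterm htpy_delta.
(* If [e] is inactive for [S], it is so for all subsets of [S], and both contraction terms
   vanish. *)
have [act|nact] := boolP (active S e); last first.
  rewrite {1}/hterm (negbTE nact) andbF linear0 add0r big1 ?sub0r => [|f _].
    by apply/suppN/supp_gterm.
  rewrite /hterm [active _ _](_ : _ = false) ?andbF ?scaler0 //.
  by apply: contraNF nact; apply: active_sub; apply: subD1set.
(* If [e] is active and in [S], only the term of [delta] that removes [e] can be contracted; [e] is
   internal, so this returns the original element exactly. *)
have [Se|nSe] := boolP (e \in S).
  have actD : active (S :\ e) e by rewrite -active_toggle setD1K.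
  rewrite {1}/hterm Se linear0 add0r (big_setD1 e) //= big1 ?addr0 => [|f]; last first.
    by rewrite !inE => /andP[fe Sf]; rewrite /hterm !inE eq_sym fe Se scaler0.
  rewrite /hterm !inE eqxx actD /= scalerA eposD1_same -expr2 sqrr_sign scale1r.
  rewrite setD1K // /theta active_bridged // subrr; exact: supp0.
(* Here [e] is active and outside [S]. Adding and removing [e] gives the original element. For [f]
   in [S], the two terms removing [f] cancel if [e] is still active for [S :\ f]; otherwise only the
   one on [e |: S :\ f] is left, and there [e] is inactive. *)
rewrite {1}/hterm nSe act linearZ /= deltaE big_setU1 //= setU1K //.
have -> : theta (e |: S) e x = x.
  rewrite /theta setU1K // [bridged _ _](_ : _ = true) //.
  by apply: bridged_sub (active_bridged act); apply: subD1set.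
rewrite scalerDr scalerA epos_setU1_same -expr2 sqrr_sign scale1r.
have cancel (a b c : C) : a + b + c - a = b + c by rewrite -(addrA a) [a + _]addrC addrK.
rewrite cancel scaler_sumr -big_split; apply: supp_sum => f Sf /=.
have fe : f != e by apply: contraNneq nSe => <-.
have -> : (e |: S) :\ f = e |: S :\ f.
  by apply/setP => g; rewrite !inE; case: (eqVneq g e) => [->|]; rewrite // eq_sym fe.
have eS : epos f (e |: S) = ((e < f) + epos f S)%N.
  by rewrite (eposD1 f (setU11 e S)) setU1K.
have [actf|nactf] := boolP (active (S :\ f) e); last first.
  rewrite /hterm (negbTE nactf) andbF scaler0 addr0.
  by apply/suppZ/suppZ/supp_gterm; rewrite active_toggle.
(* The ends of [e] are joined within [S :\ f], so the presence of [e] does not change whether [f] is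
   internal. *)
have -> : theta (e |: S) f x = theta S f x.
  rewrite /theta; have -> : (e |: S) :\ f = e |: S :\ f.
    by apply/setP => g; rewrite !inE; case: (eqVneq g e) => [->|]; rewrite // eq_sym fe.
  by rewrite /bridged conn_setU1_bridged //; apply: bridged_sub actf; apply/subsetP => g;
    rewrite inE => /andP[].
rewrite /hterm actf !inE (negbTE nSe) andbF /= !scalerA -scalerDl -!exprD.
rewrite sign_cancel ?scale0r; first exact: supp0.
rewrite eS (eposD1 e Sf) !oddD !oddb; have : (e : nat) != f by rewrite val_eqE eq_sym.
by case: ltngtP => // _ _; do 3!case: odd.
Qed.

Lemma supp_mono (P P' : pred {set edge G}) q :
  (forall S, P S -> P' S) -> supp P q -> supp P' q.
Proof. by move=> sPP' sq S nP'S; apply: sq; apply: contraNN nP'S; apply: sPP'. Qed.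

Lemma htpy_supp (P : pred {set edge G}) e q : supp P q ->
  htpy e q = \sum_(S | P S) hterm e S (BS_rep q S).
Proof.
move=> sq; rewrite {1}(supp_expand sq) htpy_sum.
by apply: eq_bigr => S _; rewrite htpy_gterm.
Qed.

(** The index is a natural number so that it can reach [esize G], where [cyclic_active] leaves no
    set at all. *)
Definition stage (t : nat) S : bool :=
  cyclic S && [forall e : edge G, (e < t)%N ==> ~~ active S e].

Lemma stageP (t : nat) S : reflect
  (cyclic S /\ forall e : edge G, (e < t)%N -> ~~ active S e) (stage t S).
Proof.
apply: (iffP andP) => -[cS aS]; split=> //.
  by move=> e et; have /forallP/(_ e)/implyP := aS; apply.
by apply/forallP => e; apply/implyP/aS.
Qed.

(** The Betti number of [e |: S] is at least two, and removing an edge lowers it by at most one. *)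
Lemma cyclic_setU1D1 S e f : e \notin S -> bridged S e -> cyclic S ->
  f \in e |: S -> cyclic ((e |: S) :\ f).
Proof.
move=> nSe eb cS Tf; have cT := cyclic_setU1 nSe eb.
have [fb|nfb] := boolP (bridged ((e |: S) :\ f) f); last by rewrite -(cyclicD1 Tf nfb).
move: cS; rewrite /cyclic (ncomp_setD1 Tf) fb addn0 (ncomp_setU1 S e) eb addn0.
by have := cardD1S Tf; rewrite cardsU1 nSe; lia.
Qed.

Lemma active_bridged_out S e : active S e -> bridged S e.
Proof. by move/active_bridged; apply: bridged_sub; apply: subD1set. Qed.

Lemma delta_stage e S x : stage e S -> e \notin S -> active S e ->
  supp (stage e) (delta (cl (gterm (e |: S) x))).
Proof.
move=> /stageP[cS aS] nSe act; rewrite deltaE; apply: supp_sum => f Tf.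
apply/suppZ/supp_gterm/stageP; split.
  exact: cyclic_setU1D1 (active_bridged_out act) cS Tf.
move=> e' e'e; apply: contraNN (aS e' e'e) => /(active_sub (subD1set _ _)).
exact: active_setU1.
Qed.

(** On a cocycle, [htpy_identity] shows that [q - delta (htpy e q)] lives where [e] is inactive,
    while [delta_stage] keeps the smaller edges inactive. *)
Lemma stage_step e q : supp (stage e) q -> delta q = 0 ->
  supp (@cyclic n G) (htpy e q) /\ supp (stage e.+1) (q - delta (htpy e q)).
Proof.
move=> sq dq; have hq := htpy_supp e sq; split.
  rewrite hq; apply: supp_sum => S /stageP[cS _]; rewrite /hterm.
  case: ifP => [_|_]; last exact: supp0.
  by apply/suppZ/supp_gterm; apply: cyclic_sub cS; apply: subsetUr.
have s1 : supp (stage e) (q - delta (htpy e q)).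
  apply: suppB sq _; rewrite hq linear_sum; apply: supp_sum => S sS; rewrite /hterm.
  case: ifP => [/andP[nSe act]|_]; last by rewrite linear0; apply: supp0.
  by rewrite linearZ; apply: suppZ; apply: delta_stage.
have s2 : supp (fun T => ~~ active T e) (q - delta (htpy e q)).
  by have /suppN := @htpy_identity e q; rewrite dq htpy0 addr0 opprB.
move=> S nS; have [sS|/s1//] := boolP (stage e S).
apply: s2; apply: contraNN nS => nact; have /stageP[cS aS] := sS.
apply/stageP; split=> // f; rewrite ltnS leq_eqVlt => /orP[/eqP/val_inj->//|].
exact: aS.
Qed.

Lemma cyclic_exact q : supp (@cyclic n G) q -> delta q = 0 ->
  exists2 b, supp (@cyclic n G) b & q = delta b.
Proof.
move=> sq dq.
have step t : (t <= esize G)%N -> exists2 b,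
    supp (@cyclic n G) b & supp (stage t) (q - delta b).
  elim: t => [_|t IHt te].
    exists 0; [exact: supp0 | rewrite linear0 subr0].
    by apply: supp_mono sq => S cS; apply/stageP.
  have [b sb sqb] := IHt (ltnW te).
  have dqb : delta (q - delta b) = 0 by rewrite linearB dq /= delta_sq subr0.
  have [sh s1] := stage_step (e := Ordinal te) sqb dqb.
  exists (b + htpy (Ordinal te) (q - delta b)); first exact: suppD.
  by rewrite linearD opprD addrA.
have [b sb sqb] := step _ (leqnn _); exists b => //.
apply/eqP; rewrite -subr_eq0; apply/eqP/supp_pred0.
apply: supp_mono sqb => S /stageP[/cyclic_active[e act]] /(_ e (ltn_ord e)).
by rewrite act.
Qed.

Lemma kerR_decomp p : kerR p -> exists a b,
  [/\ supp (@cyclic n G) a, supp (@cyclic n G) b & cl p = a + delta b].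
Proof.
elim=> {p} [_ [S x|S x|S x]||p p' _ [a [b [sa sb E]]] _ [a' [b' [sa' sb' E']]]
  |c p _ [a [b [sa sb E]]]].
- move=> Ix; exists 0, 0; split; [exact: supp0..|].
  rewrite linear0 addr0 -cl0 -(gterm0 A S); apply: BS_class_gterm.
  by rewrite subr0.
- by move=> cS; exists (cl (gterm S x)), 0; split;
    [exact: supp_gterm | exact: supp0 | rewrite linear0 addr0].
(* The terms of [D] and [delta] agree for internal edges; removing an external edge leaves a cyclic
   set. *)
- move=> cS; exists (cl (gbd S x) - delta (cl (gterm S x))), (cl (gterm S x)).
  split; [|exact: supp_gterm | by rewrite subrK].
  rewrite deltaE /gbd /ext_d cl_sum -sumrB; apply: supp_sum => e Se.
  rewrite clZ -scalerBr; apply: suppZ; rewrite /theta; case: ifPn => [_|nb].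
    by rewrite subrr; apply: supp0.
  by apply: suppB; apply: supp_gterm; rewrite -(cyclicD1 Se nb).
- by exists 0, 0; rewrite cl0 linear0 addr0; split; [exact: supp0 ..|].
- exists (a + a'), (b + b'); split; [exact: suppD ..|].
  by rewrite clD E E' linearD addrACA.
- exists (c *: a), (c *: b); split; [exact: suppZ ..|].
  by rewrite clZ E linearZ scalerDr.
Qed.
End Differential.
End GraphComplex.

(** * The quotient map *)

Section QuotientMap.
Variables (k : comPzRingType) (A : graded_algebra k) (m : nat).
Variables (pairing : A -> A -> k) (frob : frobenius m pairing).
Variables (m_even : ~~ odd m) (n : nat) (G : graph n).
Variables (Delta : tens A 2) (diag : diagonal_class pairing Delta).
Variables (C : lmodType k) (cl : {linear pre A G -> C}) (BS_rep : C -> pre A G).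
Hypothesis (BS_repK : cancel BS_rep cl).
Hypothesis (BS_classP : forall p p',
  cl p = cl p' <-> forall S, A_ideal S (p S - p' S)).
Variables (W : lmodType k) (rc : {linear pre A G -> W}) (rc_rep : W -> pre A G).
Hypothesis (rc_repK : cancel rc_rep rc).
Hypothesis (rc_ker : forall p, rc p = 0 <-> kerR p).
Variables (delta : {linear C -> C}) (d : {linear W -> W}).
Notation "'D_' e" := (tpull (esrc e) (etgt e) Delta) (at level 9).
Hypothesis (deltaE : forall S x, delta (cl (gterm S x)) =
  \sum_(e in S) (-1) ^+ epos e S *: cl (gterm (S :\ e) (theta Delta S e x))).
Hypothesis (dE : forall S x, d (rc (gterm S x)) =
  \sum_(e in S) (-1) ^+ epos e S *: rc (gterm (S :\ e) (tmul (D_ e) x))).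
Implicit Types (S : {set edge G}) (e : edge G) (x : tens A n) (p : pre A G).
Notation supp := (supp BS_rep).

Lemma rcZ c p : rc (c *: p) = c *: rc p. Proof. exact: linearZ. Qed.
Lemma rcB p p' : rc (p - p') = rc p - rc p'. Proof. exact: raddfB. Qed.
Lemma rc_sum I (r : seq I) (P : pred I) (F : I -> pre A G) :
  rc (\sum_(i <- r | P i) F i) = \sum_(i <- r | P i) rc (F i).
Proof. exact: raddf_sum. Qed.

Lemma rc_cyclic S x : cyclic S -> rc (gterm S x) = 0.
Proof. by move=> cS; apply/rc_ker/kerR_gen/ker_cyc. Qed.

Lemma rc_factor p p' : cl p = cl p' -> rc p = rc p'.
Proof.
move/BS_classP => E; apply/eqP; rewrite -subr_eq0 -rcB; apply/eqP/rc_ker.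
rewrite [p - p']pre_expand; apply: kerR_sum => S _; apply/kerR_gen/ker_A.
by rewrite preDE preNE.
Qed.

Lemma quotient_map : exists F : {linear C -> W}, forall p, F (cl p) = rc p.
Proof.
pose F q := rc (BS_rep q).
have F_cl p : F (cl p) = rc p by apply: rc_factor; rewrite BS_repK.
have F_lin : linear F.
  move=> c q q'; rewrite -[q]BS_repK -[q']BS_repK -(clZ cl) -(clD cl) !F_cl.
  exact: linearP.
by exists (HB.pack_for {linear C -> W} F (GRing.isLinear.Build k C W _ F F_lin)).
Qed.

Variables (F : {linear C -> W}) (F_cl : forall p, F (cl p) = rc p).

Lemma F_supp_cyclic q : supp (@cyclic n G) q -> F q = 0.
Proof.
move/(supp_expand BS_repK BS_classP) ->; rewrite linear_sum big1 // => S cS.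
by rewrite /= F_cl rc_cyclic.
Qed.

(** On a forest every edge is external and the formulas for [delta] and [d] coincide. On a cyclic
    [S], [F] kills [G_S (x) x], and it sends the coboundary to the class of [D(G_S) (x) x], which
    vanishes too. *)
Lemma F_chain q : F (delta q) = d (F q).
Proof.
elim/(BS_ind BS_repK): q => [|q q' Eq Eq'|S x].
- by rewrite !linear0.
- by rewrite !linearD /= Eq Eq'.
rewrite deltaE linear_sum /= F_cl.
have [cS|nS] := boolP (cyclic S); last first.
  rewrite dE; apply: eq_bigr => e Se; rewrite linearZ /= F_cl /theta.
  by rewrite ifN //; apply: contraNN nS; apply: bridged_cyclic.
rewrite rc_cyclic // linear0.
transitivity (rc (gbd S x)); last by apply/rc_ker/kerR_gen/ker_bd.
rewrite /gbd /ext_d rc_sum; apply: eq_bigr => e Se; rewrite linearZ /= F_cl rcZ /theta.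
case: ifPn => // nb; have cSe : cyclic (S :\ e) by rewrite -(cyclicD1 Se nb).
by rewrite !rc_cyclic.
Qed.

Lemma F_surj w : exists q, F q = w.
Proof. by exists (cl (rc_rep w)); rewrite F_cl rc_repK. Qed.

Lemma F_kernel q : F q = 0 -> exists a b,
  [/\ supp (@cyclic n G) a, supp (@cyclic n G) b & q = a + delta b].
Proof.
rewrite -[q]BS_repK F_cl => /rc_ker.
exact: (kerR_decomp BS_repK BS_classP deltaE).
Qed.

Lemma F_quasi_equivalence : quasi_equivalence delta d F.
Proof.
have dsq := delta_sq frob m_even diag BS_repK BS_classP deltaE.
have exact_ := cyclic_exact frob m_even diag BS_repK BS_classP deltaE.
split=> [//|w||q dq [w Fq]|w dw].
- by have [q <-] := F_surj w; rewrite -!F_chain dsq linear0.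
- exact: F_chain.
- have [q' Ew] := F_surj w.
  have /F_kernel[a [b [sa sb E]]] : F (q - delta q') = 0.
    by rewrite linearB /= F_chain Ew Fq subrr.
  have da : delta a = 0.
    have -> : a = q - delta q' - delta b by rewrite E addrK.
    by rewrite !linearB /= !dsq dq !subr0.
  have [c _ Ea] := exact_ a sa da.
  exists (q' + b + c); rewrite !linearD /= -Ea addrAC -addrA -E.
  by rewrite addrC subrK.
have [q Fq] := F_surj w.
have /F_kernel[a [b [sa sb E]]] : F (delta q) = 0 by rewrite F_chain Fq.
have da : delta a = 0.
  have -> : a = delta q - delta b by rewrite E addrK.
  by rewrite !linearB /= !dsq subrr.
have [c sc Ea] := exact_ a sa da.
(* Both [b] and [c] are supported on cyclic sets and so are killed by [F]: the corrected cocycle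
   still maps to [w] itself. *)
exists (q - b - c); split; first by rewrite !linearB /= E -Ea addrK subrr.
exists 0; rewrite linear0 addr0 !linearB /= (F_supp_cyclic sb) (F_supp_cyclic sc).
by rewrite !subr0.
Qed.

Lemma F_degree i p : pre_homog (@BS_degree k A m n G) i p ->
  exists2 q, pre_homog (@R_degree k A m n G) i q & F (cl p) = rc q.
Proof.
move=> hp; exists (\sum_(S | ~~ cyclic S) gterm S (p S)).
  move=> S w; rewrite pre_sumE => nz.
  have nS : ~~ cyclic S.
    apply: contraNN nz => cS; rewrite big1 ?tens0E // => T nT.
    by rewrite gtermE; case: eqP nT => // <-; rewrite cS.
  move: nz; rewrite (bigD1 S) //= gtermE eqxx big1 ?addr0 => [|T /andP[_ ne]]; last first.
    by rewrite gtermE eq_sym (negbTE ne).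
  move/hp <-; rewrite /R_degree /BS_degree.
  have ext e : e \in S -> external S e.
    move=> Se; rewrite /external ncomp_setD1_eq //; apply: contraNN nS.
    exact: bridged_cyclic.
  have -> : r_ext S = #|S|.
    rewrite /r_ext; congr #|pred_of_set _|; apply/setP => e; rewrite inE.
    by case: (boolP (e \in S)) => // /ext ->.
  have -> : r_int S = 0%N.
    apply/eqP; rewrite cards_eq0; apply/eqP/setP => e; rewrite !inE.
    by case: (boolP (e \in S)) => // /ext ->.
  by rewrite subr0.
rewrite F_cl {1}[p]pre_expand !rc_sum (bigID (@cyclic n G)) /= big1 ?add0r // => S.
exact: rc_cyclic.
Qed.
End QuotientMap.

(** * The differential of R on monomials *)

Section RDifferential.
Variables (k : comPzRingType) (A : graded_algebra k) (m : nat).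
Variables (pairing : A -> A -> k) (frob : frobenius m pairing).
Variables (m_even : ~~ odd m) (n : nat) (G : graph n).
Variables (Delta : tens A 2) (diag : diagonal_class pairing Delta).
Implicit Types (S : {set edge G}) (e : edge G) (x : tens A n) (p : pre A G).
Notation pmul := (@pmul k A m n G).
Notation rc := (@R_class k A m n G).
Notation "'D_' e" := (tpull (esrc e) (etgt e) Delta) (at level 9).

Lemma R_classP p p' : rc p = rc p' <-> ideal pmul (@R_relation k A m n G) (p - p').
Proof. exact: clsP. Qed.

Lemma R_repK (w : R_alg A m G) : rc (rep w) = w.
Proof. exact: repK. Qed.

Lemma R_mul_class p p' : R_mul (rc p) (rc p') = rc (pmul p p').
Proof.
rewrite /R_mul; apply/R_classP.
have /R_classP Ip := R_repK (rc p); have /R_classP Ip' := R_repK (rc p').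
set r := rep _ in Ip *; set r' := rep _ in Ip' *.
have -> : pmul r r' - pmul p p' = pmul (r - p) r' + pmul p (r' - p').
  by rewrite pmulBl pmulBr addrA subrK.
by apply: idealD; [apply: ideal_mulr | apply: ideal_mull].
Qed.

Lemma R_classZ c p : rc (c *: p) = c *: rc p. Proof. exact: linearZ. Qed.
Lemma R_class_sum I (r : seq I) (P : pred I) (F : I -> pre A G) :
  rc (\sum_(i <- r | P i) F i) = \sum_(i <- r | P i) rc (F i).
Proof. exact: raddf_sum. Qed.

Variables (d : {linear R_alg A m G -> R_alg A m G}) (d_def : R_differential Delta d).

Lemma gedge_homog e : pre_homog (@R_degree k A m n G) (m%:Z - 1) (gedge A e).
Proof.
move=> S w; rewrite /gedge gtermE; case: (S =P [set e]) => [->|_]; last by rewrite tens0E eqxx.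
by move/(tone_hdeg frob) => w0; rewrite /R_degree w0 cards1 mulr1 addr0.
Qed.

Lemma odd_edge_degree : odd `|m%:Z - 1|%N.
Proof.
move: m_even; case: (m) => [//|m'].
have -> : m'.+1%:Z - 1 = m' by lia.
by rewrite /= negbK.
Qed.

(** The least edge [e] is split off, since then [G_S = G_e G_(S :\ e)] without a sign. The Leibniz
    rule contributes -1, as [m - 1] is odd, and this accounts for the position of every other edge
    being one higher in [S] than in [S :\ e]. *)
Lemma R_differential_gterm S x : d (rc (gterm S x)) =
  \sum_(e in S) (-1) ^+ epos e S *: rc (gterm (S :\ e) (tmul (D_ e) x)).
Proof.
move: {-1}#|S| (eqxx #|S|) => c; elim: c S => [|c IHc] S cS.
  move: cS; rewrite cards_eq0 => /eqP ->; rewrite big_set0.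
  exact: (R_diff_A d_def).
have /card_gt0P[e0 Se0] : (0 < #|S|)%N by rewrite (eqP cS).
case: (arg_minnP (fun e : edge G => e : nat) Se0) => e Se emin.
have eposD f : f \in S -> epos e (S :\ e :\ f) = 0%N.
  move=> _; rewrite eposE big1 // => g; rewrite !inE => /and3P[_ _ Sg].
  by rewrite ltnNge emin.
have epos_e : epos e (S :\ e) = 0%N.
  rewrite eposE big1 // => g; rewrite !inE => /andP[_ Sg].
  by rewrite ltnNge emin.
have sgn (T : {set edge G}) : T \subset S :\ e -> epos e T = 0%N -> ext_sign k [set e] T = 1.
  move=> sT eT; rewrite /ext_sign disjoints1 [e \in T](_ : _ = false).
    by rewrite /einv big_set1 eT.
  by apply: contraTF sT => Te; apply/subsetPn; exists e; rewrite // !inE eqxx.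
have gS : gterm S x = pmul (gedge A e) (gterm (S :\ e) x).
  by rewrite /gedge (pmul_ext_gterm frob) sgn // scale1r setD1K.
rewrite {1}gS -R_mul_class (R_diff_leibniz d_def _ (@gedge_homog e)).
rewrite (R_diff_G d_def) R_mul_class pmul_pin_gterm.
rewrite (twist_even _ (@tpull_even _ _ _ _ frob m_even _ diag n _ _)).
rewrite (big_setD1 e Se) /= -[in epos e S](setD1K Se) epos_setU1_same epos_e.
rewrite expr0 scale1r; congr (_ + _).
rewrite -signr_odd odd_edge_degree expr1 scaleN1r IHc; last first.
  by move: cS; rewrite (cardD1S Se).
have -> : \sum_(f in S :\ e) (-1) ^+ epos f (S :\ e) *:
      rc (gterm (S :\ e :\ f) (tmul (D_ f) x)) =
    rc (\sum_(f in S :\ e) (-1) ^+ epos f (S :\ e) *: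
      gterm (S :\ e :\ f) (tmul (D_ f) x)).
  by rewrite R_class_sum; apply: eq_bigr => f _; rewrite R_classZ.
rewrite R_mul_class pmul_sumr R_class_sum -sumrN; apply: eq_bigr => f.
rewrite !inE => /andP[fe Sf]; rewrite pmulZr R_classZ /gedge (pmul_ext_gterm frob).
rewrite sgn ?subD1set ?eposD // scale1r.
have -> : e |: S :\ e :\ f = S :\ f.
  apply/setP => g; rewrite !inE; case: (eqVneq g e) => [->|] //=.
  by rewrite eq_sym fe; symmetry; exact: Se.
rewrite (eposD1 f Se) ltn_neqAle (emin f Sf) andbT val_eqE eq_sym fe.
by rewrite exprS mulN1r scaleNr.
Qed.
End RDifferential.

Theorem theorem8p4 (R : realType) (k : comPzRingType) (m : nat)
    (M : topologicalType) (mu : M -> @chain R M k m)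
    (A : graded_algebra k) (cl : forall q, @cochain R M k q -> A)
    (pairing : A -> A -> k)
    (m_even : ~~ odd m)
    (M_manifold : compact_connected_manifold R M m)
    (M_oriented : k_orientation mu)
    (A_cohomology : cohomology_algebra mu cl pairing)
    (A_frobenius : frobenius m pairing)
    (n : nat) (G : graph n)
    (Delta : tens A 2) (Delta_diagonal : diagonal_class pairing Delta)
    (delta : {linear C_BS A G -> C_BS A G})
    (delta_def : BS_differential Delta delta)
    (d : {linear R_alg A m G -> R_alg A m G})
    (d_def : R_differential Delta d) :
  exists F : {linear C_BS A G -> R_alg A m G},
    [/\ forall (S : {set edge G}) (x : tens A n),
          F (BS_class (gterm S x)) = R_class m (gterm S x),
        forall (i : int) (p : pre A G), pre_homog (@BS_degree k A m n G) i p ->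
          exists q : pre A G, pre_homog (@R_degree k A m n G) i q /\
            F (BS_class p) = R_class m q
      & quasi_equivalence delta d F].
Proof.
pose bc : {linear pre A G -> C_BS A G} := cls (BS_submodule A G).
pose rc : {linear pre A G -> R_alg A m G} := cls (R_submodule A m G).
have bcK : cancel (@rep _ _ (BS_submodule A G)) bc by exact: repK.
have rcK : cancel (@rep _ _ (R_submodule A m G)) rc by exact: repK.
have bcP p p' : bc p = bc p' <-> forall S, A_ideal S (p S - p' S).
  split=> [/clsP E S|E]; first by have := E S; rewrite preDE preNE.
  by apply/clsP => S; rewrite preDE preNE.
have rcP p : rc p = 0 <-> kerR p.
  rewrite -(raddf0 rc); split=> [/clsP|/(kerR_rideal A_frobenius) Ip].
    by rewrite subr0 => Ip; exact: (rideal_kerR A_frobenius Ip).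
  by apply/clsP; rewrite subr0.
have deltaE S x : delta (bc (gterm S x)) =
    \sum_(e in S) (-1) ^+ epos e S *: bc (gterm (S :\ e) (theta Delta S e x)).
  rewrite [LHS](delta_def S x); apply: eq_bigr => e Se.
  by rewrite ncomp_setD1_eq.
have dE := R_differential_gterm A_frobenius m_even Delta_diagonal d_def.
have [F F_cl] := quotient_map bcK bcP rcP.
exists F; split=> [S x|i p hp|]; first exact: F_cl.
  by have [q hq Fq] := F_degree rcP F_cl hp; exists q.
exact: (F_quasi_equivalence A_frobenius m_even Delta_diagonal bcK bcP rcK rcP deltaE dE F_cl).
Qed.
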